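(* Let $0<\alpha\le\infty$, let $E$ be a strongly symmetric function space on $[0,\alpha)$, let $k\in\mathbb{N}$ and let $f\in L^0[0,\alpha)$. The following conditions are equivalent: (i) $f$ is a $k$-extreme point of $B_E$; (ii) $\mu(f)$ is a $k$-extreme point of $B_E$ and $|f|\geq\mu(\infty,f)$ a.e. on $[0,\alpha)$.
   Context: Let $m$ be Lebesgue measure. $L^0[0,\alpha)$ is the space of complex-valued Lebesgue measurable functions on $[0,\alpha)$ (mod a.e. equality). For $f\in L^0[0,\alpha)$, $d(\lambda,f)=m\{t:|f(t)|>\lambda\}$ and $\mu(t,f)=\inf\{s>0:d(s,f)\le t\}$, $t\ge0$, is its decreasing rearrangement; $\mu(\infty,f)=\lim_{t\to\infty}\mu(t,f)$. When $\alpha<\infty$, $\mu(t,f)=0$ for $t\ge\alpha$ (so $\mu(\infty,f)=0$), and $\mu(f)$ is identified with its restriction to $[0,\alpha)$. Write $f\prec g$ if $\int_0^t\mu(f)\le\int_0^t\mu(g)$ for all $t>0$. A Banach space $E\subset L^0[0,\alpha)$ is symmetric if $f\in L^0$, $g\in E$, $\mu(f)\le\mu(g)$ imply $f\in E$ and $\|f\|_E\le\|g\|_E$; it is strongly symmetric if in addition $f,g\in E$, $f\prec g$ imply $\|f\|_E\le\|g\|_E$. For $k\in\mathbb{N}$ and a complex normed space $X$ of dimension at least $k+1$ with unit sphere $S_X$ and closed unit ball $B_X$, a point $x\in S_X$ is a $k$-extreme point of $B_X$ if whenever $x=\frac1{k+1}\sum_{i=1}^{k+1}x_i$ with all $x_i\in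 S_X$, the elements $x_1,\dots,x_{k+1}$ are linearly dependent. *)

(* Defs.v *)
From HB Require Import structures.
From mathcomp Require Import all_boot all_order all_algebra.
From mathcomp Require Import all_classical all_reals all_analysis.
From mathcomp Require Import complex.

Set Implicit Arguments.
Unset Strict Implicit.
Unset Printing Implicit Defensive.

Import Order.TTheory GRing.Theory Num.Theory.
Import numFieldNormedType.Exports.

Local Open Scope classical_set_scope.
Local Open Scope complex_scope.
Local Open Scope ring_scope.

(* [lebR R] is convertible to [R]; it carries the sigma-algebra of Lebesgue
   (Caratheodory) measurable sets, whereas the default one on [R] is Borel. *)
Notation lebR R := (caratheodory_type (@wlength R idfun)^*%mu).
Notation leb := completed_lebesgue_measure.

Section Rearrangement.
Context {R : realType}.
Variable alpha : \bar R.
Implicit Types f g : lebR R -> R[i].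

Definition dom : set (lebR R) := [set t : R | 0 <= t /\ (t%:E < alpha)%E].

(* Functions are total on the line; only their values on [dom] matter. *)
Definition L0 f : Prop :=
  measurable_fun dom (fun t => complex.Re (f t) : R) /\
  measurable_fun dom (fun t => complex.Im (f t) : R).

Definition eqL0 f g : Prop := f = g %[ae leb in dom].

Definition modulus f (t : lebR R) : R := ComplexField.Normc.normc (f t).

Definition distribution f (s : R) : \bar R :=
  leb [set t | dom t /\ s < modulus f t].

(* The value is [+oo] when the set is empty. *)
Definition rearrangement f (t : R) : \bar R :=
  ereal_inf [set s%:E | s in [set s : R | 0 < s /\ (distribution f s <= t%:E)%E]].

Definition rearrangement_infty f : \bar R :=
  lim (rearrangement f t @[t --> +oo]).

(* mu(f) as a complex-valued function. The value at [t = 0] is irrelevant a.e.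
   If mu(t,f) = +oo for some t > 0, then mu(f) = +oo identically and is not an
   element of L^0; [fine] then gives the zero function, which is not a k-extreme
   point because its norm is not 1. *)
Definition rearrangement_fun f : lebR R -> R[i] :=
  fun t => (fine (rearrangement f t))%:C.

Definition submajorized f g : Prop := forall t : R, 0 < t ->
  (\int[leb]_(s in [set` `[0%R, t]]) rearrangement f s <=
   \int[leb]_(s in [set` `[0%R, t]]) rearrangement g s)%E.

End Rearrangement.

(* A Banach space that is a linear subspace of L^0[0,alpha): a complete normed
   space with a linear injection into L^0 modulo a.e. equality, the class of
   [x] being given by its representative [fn x]. *)
Record banachFunctionSpace (R : realType) (alpha : \bar R) :=
  BanachFunctionSpace {
    carrier :> completeNormedModType R[i];
    fn : carrier -> lebR R -> R[i];
    fn_L0 : forall x, L0 alpha (fn x);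
    fn_linear : forall (a : R[i]) (x y : carrier),
      eqL0 alpha (fn (a *: x + y)) (fun t => a * fn x t + fn y t);
    fn_inj : forall x y : carrier, eqL0 alpha (fn x) (fn y) -> x = y }.

Definition represents (R : realType) (alpha : \bar R)
    (E : banachFunctionSpace alpha) (x : E) (f : lebR R -> R[i]) : Prop :=
  eqL0 alpha (fn x) f.

Definition symmetric_space (R : realType) (alpha : \bar R)
    (E : banachFunctionSpace alpha) : Prop :=
  forall (f : lebR R -> R[i]) (y : E), L0 alpha f ->
    (forall t : R, 0 <= t ->
      (rearrangement alpha f t <= rearrangement alpha (fn y) t)%E) ->
    exists2 x : E, represents x f & `|x| <= `|y|.

Definition strongly_symmetric (R : realType) (alpha : \bar R)
    (E : banachFunctionSpace alpha) : Prop :=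
  symmetric_space E /\
  forall x y : E, submajorized alpha (fn x) (fn y) -> `|x| <= `|y|.

Definition linearly_dependent (K : fieldType) (V : lmodType K) (n : nat)
    (v : 'I_n -> V) : Prop :=
  exists2 c : 'I_n -> K, exists i, c i != 0 & \sum_(i < n) c i *: v i = 0.

(* The first conjunct says that [X] has dimension at least [k.+1]; without it the
   condition on the [u i] would be vacuous. *)
Definition k_extreme (R : realType) (X : normedModType R[i]) (k : nat) (x : X)
    : Prop :=
  [/\ exists v : 'I_k.+1 -> X, ~ linearly_dependent v,
      `|x| = 1 &
      forall u : 'I_k.+1 -> X, (forall i, `|u i| = 1) ->
        x = (k.+1%:R)^-1 *: \sum_(i < k.+1) u i -> linearly_dependent u].

Definition k_extreme_fun (R : realType) (alpha : \bar R)
    (E : banachFunctionSpace alpha) (k : nat) (f : lebR R -> R[i]) : Prop :=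
  exists2 x : E, represents x f & k_extreme k x.

(* Main.v *)
Require Import Defs.
From HB Require Import structures.
From mathcomp Require Import all_boot all_order all_algebra.
From mathcomp Require Import all_classical all_reals all_analysis measurable_realfun.
From mathcomp Require Import complex ring lra.

(** Let [x] be a unit vector of a strongly symmetric space and suppose that
    [|x|] is almost everywhere at least the limit at infinity of its
    rearrangement [mu(x)]. The point is that, in a space that contains [k + 1]
    independent vectors, [x] is then k-extreme if and only if two conditions
    hold, both of which speak of [mu(x)] only:

    - [maximal_mass]: no [h] in the unit ball that submajorizes [x] has a
      strictly larger primitive of its rearrangement at any time below [alpha];
    - [dependent_means]: whenever [mu(x)] is the mean of the rearrangements of
      [k + 1] unit vectors, these rearrangements are linearly dependent.

    Since [mu(x)] itself lies above its limit, applying this to [f] and to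
    [mu(f)] gives the theorem ([k_extreme_equimeasurable]), once one knows that
    k-extreme points do lie above the limit ([k_extreme_above_limit]).

    The bridge between [x] and [mu(x)] is the function [rank], which sends a
    point to the measure of the set of points that precede it when the domain is
    ordered by decreasing modulus, and from left to right where the modulus is
    constant. It preserves measure, and the bound from below gives
    [|x| = mu(x) o rank] almost everywhere ([modulus_rank]). Rearrangements may
    jump, and it is their left limits ([mu_left]) that compose well with the
    rank.

    The two conditions suffice ([k_extreme_of_dependent_means]). If [x] is the
    mean of unit vectors [u_i], the mean [h] of the functions [mu(u_i)] is in the
    unit ball and submajorizes [x]; by maximality the primitive of [mu(x)] is the
    mean of the primitives of the [mu(u_i)]. Integrating over the sets of points
    of rank at most [r], one sees that every [u_i] is largest where [x] is, and
    then that [u_i = sgn(x) * (mu(u_i) o rank)] ([rigid_mean]). A relation between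
    the [mu(u_i)] is therefore one between the [u_i].

    They are necessary. Means of rearrangements are carried back to means equal
    to [x] by [y |-> sgn(x) * (mu(y) o rank)], which does not increase norms and
    creates no linear relation ([dependent_means_of_k_extreme]). As to maximality
    ([k_extreme_partial_mass]), [x] is submajorized by [h] exactly when the
    integral of [(|x| - w)^+] is at most that of [(|h| - w)^+] for all [w >= 0].
    If the primitives differ at [t], these integrals differ for [w] near
    [v = mu(t, x)]. Moving [|x|] slightly, with mean zero, on a small set where
    its values are [v] or just below [v] increases the integrals for [x] near [v]
    only, hence leaves [x] submajorized by [h] and in the unit ball. Such
    perturbations
    exist in arbitrarily many independent directions, so that [x] would not be
    k-extreme ([perturbation_not_k_extreme]). The same perturbations, performed
    where [|x|] stays below the limit of [mu(x)], do not even change [mu(x)]; this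
    is why k-extreme points lie above the limit. *)


Set Implicit Arguments.
Unset Strict Implicit.
Unset Printing Implicit Defensive.

Import Order.TTheory GRing.Theory Num.Theory.
Import numFieldNormedType.Exports.

Local Open Scope classical_set_scope.
Local Open Scope complex_scope.
Local Open Scope ring_scope.

(** * Lebesgue measurable sets of the line *)

Section LebesgueLine.
Context {R : realType}.
Implicit Types (A B : set (lebR R)).

Lemma measurable_lebR A : @measurable _ (measurableTypeR R) A -> measurable A.
Proof. exact: sub_caratheodory. Qed.

Lemma measurable_lebR_itv (i : interval R) : measurable ([set` i] : set (lebR R)).
Proof. by apply: measurable_lebR; exact: measurable_itv. Qed.

Lemma measurable_left (t : lebR R) : measurable ([set s : lebR R | (s : R) < t]).
Proof.
rewrite (_ : mkset _ = [set` `]-oo, (t : R)[]); first exact: measurable_lebR_itv.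
by apply/seteqP; split => s /=; rewrite in_itv.
Qed.

Lemma leb_itv (i : interval R) : leb ([set` i] : set (lebR R)) =
  if ((i.1 : \bar R) < i.2)%E then ((i.2 : \bar R) - i.1)%E else 0%E.
Proof. exact: lebesgue_measure_itv. Qed.

Lemma leb_set1 (x : R) : leb ([set x] : set (lebR R)) = 0%E.
Proof. exact: lebesgue_measure_set1. Qed.

Lemma measurable_lebR_fun (U : set (lebR R)) (h : R -> R) :
  measurable U -> measurable_fun setT h -> measurable_fun U (h : lebR R -> R).
Proof.
move=> mU mh _ Y mY; apply: measurableI => //; apply: measurable_lebR.
by rewrite -[X in measurable X]setTI; apply: mh.
Qed.

Lemma measurable_fun_superlevel d (S : measurableType d) (U : set S)
    (h : S -> R) :
  (forall y, measurable (U `&` [set t | y < h t])) -> measurable_fun U h.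
Proof.
move=> mh; apply: (measurability _ (@RGenOInfty.measurableE R)).
move=> _ [_ [y ->] <-].
have -> : h @^-1` `]y, +oo[ = [set t | y < h t].
  by apply/seteqP; split => t /=; rewrite in_itv/= andbT.
exact: mh.
Qed.

Lemma measurable_ray (x : \bar R) :
  measurable ([set t : lebR R | 0 <= t /\ ((t : R)%:E < x)%E]).
Proof.
case: x => [x| |].
- rewrite (_ : mkset _ = [set` `[0, x[]); first exact: measurable_lebR_itv.
  apply/seteqP; split => t /=; rewrite in_itv/= lte_fin; first by case=> -> ->.
  by move=> /andP[].
- rewrite (_ : mkset _ = [set` `[0, +oo[]); first exact: measurable_lebR_itv.
  apply/seteqP; split => t /=; rewrite in_itv/= andbT; first by case.
  by move=> ->; rewrite ltry.
- rewrite (_ : mkset _ = set0); first exact: measurable0.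
  by apply/seteqP; split => t //= -[].
Qed.

Lemma leb_ray (x : \bar R) : (0 <= x)%E ->
  leb ([set t : lebR R | 0 <= t /\ ((t : R)%:E < x)%E]) = x.
Proof.
case: x => [x| |] //.
- rewrite lee_fin => x0.
  rewrite (_ : mkset _ = [set` `[0, x[]); last first.
    apply/seteqP; split => t /=; rewrite in_itv/= lte_fin; first by case=> -> ->.
    by move=> /andP[].
  rewrite leb_itv/= lte_fin; have [x1|x1] := ltP 0 x; first by rewrite sube0.
  by apply/eqP; rewrite eqe eq_le x0 x1.
- move=> _; rewrite (_ : mkset _ = [set` `[0, +oo[]); last first.
    apply/seteqP; split => t /=; rewrite in_itv/= andbT; first by case.
    by move=> ->; rewrite ltry.
  by rewrite leb_itv/= ltry.
Qed.

End LebesgueLine.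

Section AlmostEverywhere.
Context d (T : measurableType d) {R : realType}.
Variable mu : {measure set T -> \bar R}.

Lemma ae_le_measure (A B : set T) : measurable A -> measurable B ->
  {ae mu, forall t, A t -> B t} -> (mu A <= mu B)%E.
Proof.
move=> mA mB [N [mN N0 AB]].
rewrite -(measureU0 mB mN N0); apply: le_measure; rewrite ?inE//.
  exact: measurableU.
by move=> t At; have [Bt|nBt] := pselect (B t);[left|right; apply: AB => /(_ At)].
Qed.

(** Continuity of measures from below, in the form used to pass to the limit in a
    bound. *)
Lemma nondecreasing_measure_le (F : (set T)^nat) (y : \bar R) :
  (forall n, measurable (F n)) -> {homo F : n m / (n <= m)%N >-> n `<=` m} ->
  (forall n, mu (F n) <= y)%E -> (mu (\bigcup_n F n) <= y)%E.
Proof.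
move=> mF ndF Fy.
have ndF' : {homo F : n m / (n <= m)%N >-> (n <= m)%O}.
  by move=> n m nm; apply/subsetPset; exact: ndF.
have H := nondecreasing_cvg_mu (mu := mu) mF (bigcupT_measurable F mF) ndF'.
rewrite -(cvg_lim _ H)//; apply: lime_le; first by apply/cvg_ex; eexists; exact: H.
exact: nearW.
Qed.

Lemma ae_eq_measure (A B : set T) : measurable A -> measurable B ->
  {ae mu, forall t, A t <-> B t} -> mu A = mu B.
Proof.
move=> mA mB AB; apply/eqP; rewrite eq_le; apply/andP; split;
  by apply: ae_le_measure => //; apply: filterS AB => t [].
Qed.

End AlmostEverywhere.

(** * Distribution functions and decreasing rearrangements *)

Section Distribution.
Context {R : realType}.
Variable alpha : \bar R.
Hypothesis alpha_gt0 : (0 < alpha)%E.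
Implicit Types f g : lebR R -> R[i].
Local Notation D := (dom alpha).
Local Notation dist := (Defs.distribution alpha).
Local Notation rearr := (rearrangement alpha).

Lemma measurable_dom : measurable D.
Proof. exact: measurable_ray. Qed.
Hint Resolve measurable_dom : core.

Lemma leb_dom : leb D = alpha.
Proof. by apply: leb_ray; exact: ltW. Qed.

Lemma modulusE f t : (modulus f t)%:C = `|f t|.
Proof. by []. Qed.

Lemma modulus_ge0 f t : 0 <= modulus f t.
Proof. by rewrite -lecR modulusE normr_ge0. Qed.

Lemma measurable_modulus f : L0 alpha f -> measurable_fun D (modulus f).
Proof.
move=> [mRe mIm].
have -> : modulus f = Num.sqrt \o
    (fun t => complex.Re (f t) ^+ 2 + complex.Im (f t) ^+ 2).
  by apply/funext => t; rewrite /modulus /=; case: (f t).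
apply: measurableT_comp.
  apply: continuous_measurable_fun => x; exact: sqrt_continuous.
apply: measurable_funD; apply: measurable_funX; [exact: mRe|exact: mIm].
Qed.

Lemma measurable_superlevel f s : L0 alpha f ->
  measurable [set t | D t /\ s < modulus f t].
Proof.
move=> /measurable_modulus mf.
have := mf measurable_dom [set` `]s, +oo[] (measurable_itv _).
congr measurable; apply/seteqP; split => t /=; rewrite in_itv/= andbT;
  by move=> [].
Qed.

Lemma dist_ge0 f s : (0 <= dist f s)%E.
Proof. exact: measure_ge0. Qed.

Lemma dist_le_alpha f s : L0 alpha f -> (dist f s <= alpha)%E.
Proof.
move=> mf; rewrite -[leRHS]leb_dom; apply: le_measure; rewrite ?inE//.
- exact: measurable_superlevel.
- by move=> t [].
Qed.

Lemma dist_le f s s' : L0 alpha f -> s <= s' -> (dist f s' <= dist f s)%E.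
Proof.
move=> mf ss'; apply: le_measure; rewrite ?inE//; try exact: measurable_superlevel.
by move=> t /= [Dt s't]; split => //; exact: le_lt_trans s't.
Qed.

(** The superlevel set at [v] is the increasing union of those at levels above
    [v]. *)
Lemma dist_right_cont f v (y : \bar R) : L0 alpha f ->
  (forall s, v < s -> (dist f s <= y)%E) -> (dist f v <= y)%E.
Proof.
move=> mf H.
pose F n := [set t | D t /\ v + n.+1%:R^-1 < modulus f t].
have FE : [set t | D t /\ v < modulus f t] = \bigcup_n F n.
  apply/seteqP; split => t /= => [[Dt vt]|[n _ [Dt nt]]]; last first.
    by split => //; apply: le_lt_trans nt; rewrite lerDl.
  have vt' : 0 < modulus f t - v by rewrite subr_gt0.
  have [n _ /(_ n (leqnn n))/= nt] := near_infty_natSinv_lt (PosNum vt').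
  by exists n => //; split => //; rewrite addrC -ltrBrDr.
have mF n : measurable (F n) by exact: measurable_superlevel.
rewrite /Defs.distribution FE; apply: nondecreasing_measure_le => // n.
  move=> m nm t [Dt nt]; split => //; apply: le_lt_trans nt.
  by rewrite lerD2l lef_pV2 ?posrE// ler_nat.
by apply: H; rewrite ltrDl.
Qed.

Lemma rearr_ge0 f t : (0 <= rearr f t)%E.
Proof.
by apply: le_ereal_inf_tmp => _ [s [s0 _] <-]; rewrite lee_fin ltW.
Qed.

(** The two functions form a Galois connection because distribution functions are
    right-continuous. *)
Lemma rearr_le f t v : L0 alpha f -> 0 <= v ->
  (rearr f t <= v%:E)%E = (dist f v <= t%:E)%E.
Proof.
move=> mf v0; apply/idP/idP => [H|H].
  apply: dist_right_cont => // s vs.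
  have : (rearr f t < s%:E)%E by rewrite (le_lt_trans H)// lte_fin.
  move=> /ereal_inf_lt[_ [s' [s'0 s't] <-]]; rewrite lte_fin => s's.
  by apply: le_trans s't; apply: dist_le => //; exact: ltW.
apply/lee_addgt0Pr => e e0; apply: ereal_inf_lbound.
exists (v + e); last by rewrite EFinD.
split; first exact: ltr_wpDl.
by apply: le_trans H; apply: dist_le => //; rewrite lerDl ltW.
Qed.

Lemma rearr_gt f t v : L0 alpha f -> 0 <= v ->
  (v%:E < rearr f t)%E = (t%:E < dist f v)%E.
Proof. by move=> mf v0; rewrite !ltNge rearr_le. Qed.

Lemma rearr_noninc f t t' : L0 alpha f -> t <= t' -> (rearr f t' <= rearr f t)%E.
Proof.
move=> mf tt'; apply: le_ereal_inf_tmp => _ [s [s0 st] <-].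
by apply: ereal_inf_lbound; exists s => //; split => //; rewrite (le_trans st).
Qed.

Lemma rearr_ge_alpha f t : L0 alpha f -> (alpha <= t%:E)%E -> rearr f t = 0%E.
Proof.
move=> mf at'; apply/eqP; rewrite eq_le rearr_ge0 andbT.
by rewrite rearr_le//; apply: le_trans at'; exact: dist_le_alpha.
Qed.

Lemma eqL0_dist f g s : L0 alpha f -> L0 alpha g -> eqL0 alpha f g ->
  dist f s = dist g s.
Proof.
move=> mf mg fg; apply: ae_eq_measure; try exact: measurable_superlevel.
by apply: filterS fg => t fg; split => -[Dt]; move: (fg Dt); rewrite /modulus /= => ->.
Qed.

Lemma eqL0_rearr f g t : L0 alpha f -> L0 alpha g -> eqL0 alpha f g ->
  rearr f t = rearr g t.
Proof.
move=> mf mg fg; congr ereal_inf; congr image; apply/seteqP; split => s /= [s0];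
  by rewrite (eqL0_dist s mf mg fg).
Qed.

End Distribution.

(** * Integrals above a level and primitives of rearrangements *)

Section LayerCake.
Context d (T : measurableType d) {R : realType}.
Variable mu : {sigma_finite_measure set T -> \bar R}.

(** Both sides measure the region between the level [v] and the graph of [h]
    (Tonelli). *)
Lemma layer_cake (U : set T) (h : T -> R) (v : R) :
  measurable U -> measurable_fun U h ->
  (\int[mu]_(t in U) (Num.max (h t - v) 0)%:E =
   \int[leb]_(s in [set s : lebR R | (v <= s)%R])
     mu (U `&` [set t | ((s : R) < h t)%R]))%E.
Proof.
move=> mU mh.
pose A : set (T * lebR R) := [set p | U p.1 /\ v <= (p.2 : R) < h p.1].
have mid : measurable_fun setT (fun p : T * lebR R => (p.2 : R)).
  apply: (@measurableT_comp _ _ _ _ _ _ (id : lebR R -> R)).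
    by apply: measurable_lebR_fun => //; exact: measurable_id.
  exact: measurable_snd.
have mA : measurable A.
  have mhU : measurable_fun setT (fun p : T * lebR R => (h \_ U) p.1).
    apply: (@measurableT_comp _ _ _ _ _ _ (h \_ U)); last exact: measurable_fst.
    exact: (measurable_restrictT h mU).1.
  have -> : A = ((@fst T (lebR R)) @^-1` U) `&`
     ((fun p : T * lebR R => v <= (p.2 : R)) @^-1` [set true] `&`
      (fun p : T * lebR R => (p.2 : R) < (h \_ U) p.1) @^-1` [set true]).
    apply/seteqP; split => -[t s] /=.
      by move=> [Ut /andP[vs sh]]; rewrite patchE mem_set// vs sh.
    by move=> [Ut]; rewrite patchE mem_set// => -[vs sh]; split=> //; rewrite vs sh.
  apply: measurableI.
    by rewrite -[X in measurable X]setTI; exact: measurable_fst.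
  apply: measurableI; rewrite -[X in measurable X]setTI.
    by apply: measurable_fun_ler => //; exact: measurable_cst.
  exact: measurable_fun_ltr.
have := indic_fubini_tonelli mu (leb : {sigma_finite_measure set (lebR R) -> \bar R}) mA.
rewrite indic_fubini_tonelli_FE// indic_fubini_tonelli_GE// => H.
rewrite integral_mkcond [RHS]integral_mkcond.
transitivity (\int[mu]_x ((leb : set (lebR R) -> \bar R) \o xsection A) x)%E.
  apply: eq_integral => t _; rewrite patchE; case: ifPn => Ut.
    rewrite /= (_ : xsection A t = [set` `[v, h t[]).
      rewrite leb_itv/= lte_fin; case: ltP => vh.
        by rewrite max_l// subr_ge0 ltW.
      by rewrite max_r// subr_le0.
    apply/seteqP; split => s; rewrite /xsection/= in_itv/= inE/=; first by case.
    by rewrite inE in Ut.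
  rewrite /= (_ : xsection A t = set0) ?measure0//.
  apply/seteqP; split => s //; rewrite /xsection/= inE/= => -[Ut' _].
  by rewrite notin_setE in Ut.
rewrite H; apply: eq_integral => s _; rewrite patchE; case: ifPn => vs.
  rewrite inE/= in vs; congr (mu _); apply/seteqP; split => t.
    by rewrite /ysection/= inE => -[Ut /andP[_ sh]].
  by rewrite /ysection/= inE => -[Ut sh]; split => //=; rewrite vs.
rewrite /= (_ : ysection A s = set0) ?measure0//.
apply/seteqP; split => t //; rewrite /ysection/= inE/= => -[Ut /andP[vs' _]].
by rewrite notin_setE in vs.
Qed.

End LayerCake.

Section Rearranged.
Context {R : realType}.
Variable alpha : \bar R.
Hypothesis alpha_gt0 : (0 < alpha)%E.
Implicit Types f g : lebR R -> R[i].
Local Notation D := (dom alpha).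
Local Notation dist := (Defs.distribution alpha).
Local Notation rearr := (rearrangement alpha).

Definition finite_rearrangement f :=
  forall t, 0 < t -> (rearr f t < +oo)%E.

Definition mu_real f (t : R) : R := fine (rearr f t).
Local Notation mr := mu_real.

(** Excesses are dual to primitives of rearrangements: see [partial_massE] and
    [submajorized_excess]. Unlike the latter they are computed on the domain
    itself, and a change of mean zero near one value of [|f|] increases them only
    at nearby levels. *)
Definition excess f (v : R) : \bar R :=
  (\int[leb]_(t in D) (Num.max (modulus f t - v) 0)%:E)%E.

(** The interval is open at 0 because the rearrangement may be infinite there. *)
Definition partial_mass f (t : R) : \bar R :=
  (\int[leb]_(s in [set` `]0%R, t[]) (mr f s)%:E)%E.

Lemma mu_realE f t : finite_rearrangement f -> 0 < t ->
  (mr f t)%:E = rearr f t.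
Proof.
move=> ff t0; rewrite /mu_real fineK// ge0_fin_numE ?rearr_ge0//; exact: ff.
Qed.

Lemma mu_real_ge0 f t : 0 <= mr f t.
Proof. by apply: fine_ge0; exact: rearr_ge0. Qed.

Lemma mu_real_le f t v : L0 alpha f -> finite_rearrangement f -> 0 < t ->
  0 <= v -> (mr f t <= v) = (dist f v <= t%:E)%E.
Proof. by move=> mf ff t0 v0; rewrite -rearr_le// -mu_realE// lee_fin. Qed.

Lemma mu_real_gt f t v : L0 alpha f -> finite_rearrangement f -> 0 < t ->
  0 <= v -> (v < mr f t) = (t%:E < dist f v)%E.
Proof. by move=> mf ff t0 v0; rewrite !ltNge mu_real_le. Qed.

Lemma mu_real_noninc f t t' : L0 alpha f -> finite_rearrangement f -> 0 < t ->
  t <= t' -> mr f t' <= mr f t.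
Proof.
move=> mf ff t0 tt'; rewrite -lee_fin !mu_realE//.
  by apply: rearr_noninc.
exact: lt_le_trans tt'.
Qed.

Lemma superlevel_mu_real f v : L0 alpha f -> finite_rearrangement f -> 0 <= v ->
  [set` `]0, +oo[] `&` [set t : lebR R | v < mr f t] =
  [set t : lebR R | 0 <= t /\ ((t : R)%:E < dist f v)%E] `\` [set 0].
Proof.
move=> mf ff v0; apply/seteqP; split => t /=; rewrite in_itv/= andbT.
  move=> [t0]; rewrite mu_real_gt// => tv; split; first by rewrite ltW.
  by apply/eqP; rewrite gt_eqF.
move=> [[t0 tv] /eqP tn0]; have {}t0 : 0 < t by rewrite lt_neqAle eq_sym tn0.
by rewrite mu_real_gt.
Qed.

Lemma measurable_mu_real f : L0 alpha f -> finite_rearrangement f ->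
  measurable_fun ([set` `]0, +oo[] : set (lebR R)) (mr f : lebR R -> R).
Proof.
move=> mf ff; apply: measurable_fun_superlevel => y.
have [y0|y0] := leP 0 y.
  rewrite superlevel_mu_real//; apply: measurableD; first exact: measurable_ray.
  by apply: measurable_lebR; exact: measurable_set1.
rewrite setIidl; first exact: measurable_lebR_itv.
by move=> t _ /=; rewrite (lt_le_trans y0)// mu_real_ge0.
Qed.

Lemma leb_superlevel_mu_real f v : L0 alpha f -> finite_rearrangement f ->
  0 <= v -> leb ([set` `]0, +oo[] `&` [set t : lebR R | v < mr f t]) = dist f v.
Proof.
move=> mf ff v0; rewrite superlevel_mu_real//.
rewrite -[RHS]leb_ray ?dist_ge0//; apply: ae_eq_measure.
- apply: measurableD; first exact: measurable_ray.
  by apply: measurable_lebR; exact: measurable_set1.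
- exact: measurable_ray.
- exists [set 0]; split; first by apply: measurable_lebR; exact: measurable_set1.
    exact: leb_set1.
  move=> t /= H; apply: contrapT => t0; apply: H; split; first by case.
  by move=> H; split.
Qed.

(** Both sides are the integral over [[v, +oo[] of the distribution function. *)
Lemma excessE f v : L0 alpha f -> finite_rearrangement f -> 0 <= v ->
  excess f v = (\int[leb]_(t in [set` `]0%R, +oo[])
                   (Num.max (mr f t - v) 0)%:E)%E.
Proof.
move=> mf ff v0; rewrite /excess layer_cake; last 2 first.
  exact: measurable_dom.
  exact: measurable_modulus.
rewrite layer_cake; last 2 first.
  exact: measurable_lebR_itv.
  exact: measurable_mu_real.
apply: eq_integral => s; rewrite inE/= => vs.
by rewrite leb_superlevel_mu_real// (le_trans v0).
Qed.

End Rearranged.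

Section Levels.
Context d (T : measurableType d) {R : realType}.
Variable mu : {measure set T -> \bar R}.
Variables (U : set T) (h : T -> R).
Hypotheses (mU : measurable U) (mh : measurable_fun U h).

Lemma measurable_pospart v :
  measurable_fun U (fun t => (Num.max (h t - v) 0)%:E).
Proof.
apply/measurable_EFinP; apply: measurable_maxr; last exact: measurable_cst.
by apply: measurable_funB => //; exact: measurable_cst.
Qed.

Lemma pospart_ge0 (x v : R) : (0 <= (Num.max (x - v) 0)%:E)%E.
Proof. by rewrite lee_fin le_max lexx orbT. Qed.

Lemma integral_level v : 0 <= v ->
  (\int[mu]_(t in U) (v + Num.max (h t - v) 0)%:E =
   v%:E * mu U + \int[mu]_(t in U) (Num.max (h t - v) 0)%:E)%E.
Proof.
move=> v0; rewrite -integral_cst// -ge0_integralD//.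
  by move=> t _; exact: pospart_ge0.
exact: measurable_pospart.
Qed.

Lemma integral_le_level v : 0 <= v -> (forall t, U t -> 0 <= h t) ->
  (\int[mu]_(t in U) (h t)%:E <=
   v%:E * mu U + \int[mu]_(t in U) (Num.max (h t - v) 0)%:E)%E.
Proof.
move=> v0 h0; rewrite -integral_level//; apply: ge0_le_integral => //.
- exact/measurable_EFinP.
- apply/measurable_EFinP; apply: measurable_funD; first exact: measurable_cst.
  exact/measurable_EFinP/measurable_pospart.
- by move=> t Ut; rewrite lee_fin -lerBlDl le_max lexx.
Qed.

Lemma integral_eq_level v : 0 <= v -> (forall t, U t -> v <= h t) ->
  (\int[mu]_(t in U) (h t)%:E =
   v%:E * mu U + \int[mu]_(t in U) (Num.max (h t - v) 0)%:E)%E.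
Proof.
move=> v0 h0; rewrite -integral_level//; apply: eq_integral => t.
by rewrite inE => Ut; rewrite max_l ?subr_ge0 ?h0// subrKC.
Qed.

End Levels.

Section Mass.
Context {R : realType}.
Variable alpha : \bar R.
Hypothesis alpha_gt0 : (0 < alpha)%E.
Implicit Types f g : lebR R -> R[i].
Local Notation D := (dom alpha).
Local Notation dist := (Defs.distribution alpha).
Local Notation rearr := (rearrangement alpha).
Local Notation mr := (mu_real alpha).
Local Notation K := (partial_mass alpha).
Local Notation Phi := (excess alpha).
Local Notation finr := (finite_rearrangement alpha).

Let measurable_D : measurable D. Proof. exact: measurable_dom. Qed.
Let m0t (t : R) : measurable ([set` `]0%R, t[] : set (lebR R)).
Proof. exact: measurable_lebR_itv. Qed.
Let m0y : measurable ([set` `]0%R, +oo[] : set (lebR R)).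
Proof. exact: measurable_lebR_itv. Qed.
Hint Resolve measurable_D m0t m0y : core.

Lemma leb_itv0 (t : R) : 0 < t -> leb ([set` `]0%R, t[] : set (lebR R)) = t%:E.
Proof. by move=> t0; rewrite leb_itv/= lte_fin t0 sube0. Qed.

Let sub0y (t : R) : [set` `]0%R, t[] `<=` ([set` `]0%R, +oo[] : set (lebR R)).
Proof. by move=> x /=; rewrite !in_itv/= andbT => /andP[]. Qed.

Lemma measurable_mu_real_itv f t : L0 alpha f -> finr f ->
  measurable_fun ([set` `]0%R, t[] : set (lebR R)) (mr f : lebR R -> R).
Proof.
by move=> mf ff; apply: (measurable_funS m0y (@sub0y t)); exact: measurable_mu_real.
Qed.

Lemma excess_ge0 f v : (0 <= Phi f v)%E.
Proof. by apply: integral_ge0 => t _; apply: pospart_ge0. Qed.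

Lemma partial_mass_ge0 f t : (0 <= K f t)%E.
Proof. by apply: integral_ge0 => s _; rewrite lee_fin mu_real_ge0. Qed.

(** The right-hand side, minimised over [v], is the K-functional of the couple
    (L^1, L^infty) at [f]; by [partial_massE] the minimum is attained at the value
    of the rearrangement at [t]. *)
Lemma partial_mass_le f v t : L0 alpha f -> finr f -> 0 <= v -> 0 < t ->
  (K f t <= Phi f v + (t * v)%:E)%E.
Proof.
move=> mf ff v0 t0; rewrite excessE// /partial_mass.
have H := integral_le_level leb (m0t t) (measurable_mu_real_itv mf ff) v0
  (fun s _ => mu_real_ge0 alpha f s).
apply: (le_trans H).
rewrite /= leb_itv0// -EFinM mulrC addeC leeD2r//.
apply: (ge0_subset_integral leb (m0t t) m0y); last exact: sub0y.
  exact: (measurable_pospart (measurable_mu_real mf ff)).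
by move=> s _; apply: pospart_ge0.
Qed.

Lemma partial_massE f t : L0 alpha f -> finr f -> 0 < t ->
  K f t = (Phi f (mr f t) + (t * mr f t)%:E)%E.
Proof.
move=> mf ff t0; have v0 := mu_real_ge0 alpha f t.
rewrite excessE// /partial_mass (integral_eq_level leb (m0t t)
  (measurable_mu_real_itv mf ff) v0); last first.
  move=> s /=; rewrite in_itv/= => /andP[s0 st].
  by apply: mu_real_noninc => //; exact: ltW.
rewrite /= leb_itv0// -EFinM mulrC addeC; congr (_ + _)%E.
rewrite integral_mkcond [RHS]integral_mkcond; apply: eq_integral => s _.
rewrite !patchE; case: ifPn; rewrite ?inE ?notin_setE/= in_itv/=.
  by move=> /andP[s0 st]; rewrite mem_set//= in_itv/= s0.
case: ifPn; rewrite ?inE/= ?in_itv/= ?andbT// => s0 /negP.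
rewrite s0/= -leNgt => ts.
by rewrite max_r// subr_le0 mu_real_noninc.
Qed.

(** The inequality of Hardy and Littlewood, read off the K-functional. *)
Lemma integral_le_partial_mass f (B : set (lebR R)) t : L0 alpha f -> finr f ->
  0 < t -> measurable B -> B `<=` D -> (leb B <= t%:E)%E ->
  (\int[leb]_(s in B) (modulus f s)%:E <= K f t)%E.
Proof.
move=> mf ff t0 mB BD Bt; rewrite partial_massE//.
have v0 := mu_real_ge0 alpha f t.
have mg : measurable_fun B (modulus f).
  by apply: (measurable_funS _ BD) => //; exact: measurable_modulus.
apply: (le_trans (integral_le_level leb mB mg v0 _)).
  by move=> s _; exact: modulus_ge0.
rewrite addeC; apply: leeD.
  rewrite /excess; apply: (ge0_subset_integral leb mB measurable_D); last exact: BD.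
    exact: (measurable_pospart (measurable_modulus mf)).
  by move=> s _; apply: pospart_ge0.
by rewrite EFinM muleC lee_wpmul2r// lee_fin.
Qed.

(** An excess is the supremum over [t] of [partial_mass f t - t * v], the integral
    up to [t] of the rearrangement minus [v]. *)
Lemma submajorized_excess f g v : L0 alpha f -> finr f -> L0 alpha g ->
  finr g -> 0 <= v -> (forall t, 0 < t -> (K f t <= K g t)%E) ->
  (Phi f v <= Phi g v)%E.
Proof.
move=> mf ff mg fg v0 fg_le; rewrite excessE//.
pose F (n : nat) : set (lebR R) := [set` `]0%R, n%:R[].
have UF : \bigcup_n F n = [set` `]0%R, +oo[].
  apply/seteqP; split => t /=; first by move=> [n _]; exact: sub0y.
  rewrite in_itv/= andbT => t0; exists (Num.truncn t).+1 => //=.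
  by rewrite /F/= in_itv/= t0/= truncnS_gt.
have ndF : {homo F : n m / (n <= m)%N >-> (n <= m)%O}.
  move=> n m nm; apply/subsetPset => t; rewrite /F/= !in_itv/= => /andP[-> /=].
  by move=> /lt_le_trans; apply; rewrite ler_nat.
have mmax : measurable_fun ([set` `]0%R, +oo[] : set (lebR R))
    (fun t : lebR R => (Num.max (mr f t - v) 0)%:E).
  by apply: measurable_pospart => //; exact: measurable_mu_real.
have H := ge0_nondecreasing_set_cvg_integral (mu := leb) ndF
  (fun n => measurable_lebR_itv _)
  (fun n => measurable_funS m0y (@sub0y n%:R) mmax)
  (fun n t _ => pospart_ge0 _ _).
rewrite UF in H; rewrite -(cvg_lim _ H)//.
apply: lime_le; first by apply/cvg_ex; eexists; exact: H.
apply: nearW => n.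
(* Only the part of ]0, n[ below [dist f v] contributes. *)
have [d0|d0] := eqVneq (dist f v) 0%E.
  rewrite integral0_eq ?excess_ge0// => t; rewrite /F/= in_itv/= => /andP[t0 _].
  by rewrite max_r// subr_le0 mu_real_le// d0 lee_fin ltW.
have [->|n0] := eqVneq n 0%N.
  rewrite (_ : F 0%N = set0) ?integral_set0 ?excess_ge0//.
  apply/seteqP; split => t //=; rewrite /F/= in_itv/= => /andP[t0 /(lt_trans t0)].
  by rewrite ltxx.
pose c := fine (Order.min (dist f v) n%:R%:E).
have cE : c%:E = Order.min (dist f v) n%:R%:E.
  rewrite /c fineK// ge0_fin_numE.
    by rewrite gt_min ltry orbT.
  by rewrite le_min dist_ge0 lee_fin/=.
have c0 : 0 < c.
  rewrite -lte_fin cE lt_min lte_fin ltr0n lt0n n0 andbT.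
  by rewrite lt_neqAle eq_sym d0 dist_ge0.
have -> : (\int[leb]_(t in F n) (Num.max (mr f t - v) 0)%:E =
    \int[leb]_(t in [set` `]0%R, c[]) (Num.max (mr f t - v) 0)%:E)%E.
  rewrite integral_mkcond [RHS]integral_mkcond; apply: eq_integral => t _.
  rewrite !patchE; case: ifPn; case: ifPn => //;
    rewrite /F ?inE ?notin_setE/= !in_itv/=.
    move=> /negP + /andP[t0 tn]; rewrite t0/= -leNgt -lee_fin cE ge_min.
    rewrite lee_fin [(n%:R <= _)%R]leNgt tn orbF => dt.
    by rewrite max_r// subr_le0 mu_real_le.
  move=> /andP[t0 + /negP]; rewrite t0/= -leNgt -lte_fin cE lt_min.
  by rewrite lte_fin => /andP[_ tn] nt; move: tn; rewrite ltNge nt.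
have vt : ((c * v)%:E +
    \int[leb]_(t in [set` `]0%R, c[]) (Num.max (mr f t - v) 0)%:E <= K f c)%E.
  rewrite /partial_mass (@integral_eq_level _ _ _ leb _ (mr f) (m0t c) _ v) //=.
  - by rewrite leb_itv0// -EFinM [(v * c)%R]mulrC.
  - exact: measurable_mu_real_itv.
  move=> t /=; rewrite in_itv/= => /andP[t0 tc].
  rewrite ltW// mu_real_gt//; apply: lt_le_trans (_ : (c%:E <= _)%E).
    by rewrite lte_fin.
  by rewrite cE ge_min lexx.
have := le_trans vt (le_trans (fg_le _ c0) (partial_mass_le mg fg v0 c0)).
by rewrite [leRHS]addeC leeD2lE.
Qed.

Lemma measurable_rearr f : L0 alpha f ->
  measurable_fun ([set` `[0%R, +oo[] : set (lebR R)) (rearr f : lebR R -> \bar R).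
Proof.
move=> mf; apply: (measurability _ (@ErealGenOInfty.measurableE R)).
move=> _ [_ [y ->] <-].
have m0 : measurable ([set` `[0%R, +oo[] : set (lebR R)).
  exact: measurable_lebR_itv.
have [y0|y0] := leP 0 y; last first.
  rewrite setIidl// => t _ /=; rewrite in_itv/= andbT.
  by rewrite (@lt_le_trans _ _ 0%E)// rearr_ge0.
rewrite (_ : _ `&` _ = [set t : lebR R | 0 <= t /\ ((t : R)%:E < dist f y)%E]).
  exact: measurable_ray.
apply/seteqP; split => t /=; rewrite !in_itv/= !andbT rearr_gt//.
Qed.

Lemma integral_rearr f t : L0 alpha f -> finr f -> 0 < t ->
  (\int[leb]_(s in [set` `[0%R, t]]) rearr f s = K f t)%E.
Proof.
move=> mf ff t0.
have m2 : measurable ([set 0; t] : set (lebR R)).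
  by apply: measurable_lebR; apply: measurableU; exact: measurable_set1.
rewrite (@ge0_negligible_integral _ _ _ leb [set` `[0%R, t]] [set 0; t])//.
- rewrite (_ : _ `\` _ = [set` `]0%R, t[]).
    apply: eq_integral => s; rewrite inE/= in_itv/= => /andP[s0 _].
    by rewrite mu_realE.
  apply/seteqP; split => s /=; rewrite !in_itv/=.
    move=> [/andP[s0 st] /not_orP[/eqP n0 /eqP nt]].
    by rewrite !lt_neqAle s0 st nt eq_sym n0.
  move=> /andP[s0 st]; rewrite !ltW//; split => // -[] /eqP.
    by rewrite gt_eqF.
  by rewrite lt_eqF.
- exact: measurable_lebR_itv.
- apply: measurable_funS (measurable_rearr mf); first exact: measurable_lebR_itv.
  by move=> s /=; rewrite !in_itv/= andbT => /andP[].
- by move=> s _; exact: rearr_ge0.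
- apply/eqP; rewrite -measure_le0; apply: le_trans (measureU2 _ _ _) _.
  + by apply: measurable_lebR; exact: measurable_set1.
  + by apply: measurable_lebR; exact: measurable_set1.
  + by rewrite /= !leb_set1 adde0.
Qed.

End Mass.

(** * Ranking the points of the domain by decreasing modulus *)

Section Slicing.
Context {R : realType}.

Section InitialSegment.
Variable A : set (lebR R).
Hypotheses (mA : measurable A) (A_ge0 : forall t, A t -> 0 <= (t : R)).

Definition left_mass (t : lebR R) : \bar R := leb (A `&` [set s | (s : R) < t]).
Local Notation F := left_mass.

Let mlt := @measurable_left R.

Lemma left_mass_le (s t : lebR R) : (s : R) <= t -> (F s <= F t)%E.
Proof.
move=> st; apply: le_measure; rewrite ?inE; try exact: measurableI.
by move=> u [Au us]; split => //; exact: lt_le_trans st.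
Qed.

Lemma measurable_initial (x : \bar R) : measurable (A `&` [set t | (F t <= x)%E]).
Proof.
apply: measurableI => //; apply: measurable_lebR.
apply: is_interval_measurable => s t /= sx tx u /andP[su ut].
exact: le_trans (left_mass_le ut) tx.
Qed.

(** An instance of the intermediate value theorem: the measure of the part of [A]
    left of [t] varies continuously with [t]. *)
Lemma leb_initial (x : R) : 0 <= x ->
  leb (A `&` [set t | (F t <= x%:E)%E]) = Order.min (leb A) x%:E.
Proof.
move=> x0; set I := A `&` _.
have mI : measurable I by exact: measurable_initial.
have IA : (leb I <= leb A)%E.
  by apply: le_measure; rewrite ?inE//; exact: subIsetl.
have J0 : (F 0%R <= x%:E)%E.
  rewrite /F (_ : A `&` _ = set0) ?measure0 ?lee_fin//.
  by apply/seteqP; split => t //= -[/A_ge0 t0]; rewrite ltNge t0.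
have [ubJ|nubJ] := pselect (has_ubound [set t : R | (F t <= x%:E)%E]).
  have hJ : has_sup [set t : R | (F t <= x%:E)%E] by split => //; exists (0 : R).
  set y := sup [set t : R | (F t <= x%:E)%E].
  have ltJ t : t < y -> (F t <= x%:E)%E.
    move=> /(sup_gt hJ.1)[s Fs ts].
    by apply: le_trans Fs; apply: left_mass_le; exact: ltW.
  have gtJ t : y < t -> (x%:E < F t)%E.
    move=> yt; rewrite ltNge; apply/negP => Ft.
    by have := ub_le_sup ubJ Ft; rewrite -/y leNgt yt.
  have leI : (leb I <= x%:E)%E.
    have -> : leb I = leb (I `&` [set s | (s : R) < y]).
      apply: ae_eq_measure => //; first exact: measurableI.
      exists [set y]; split; last 2 first.
        exact: leb_set1.
        move=> t /= nt; apply: contrapT => ty; apply: nt; split=> [It|[]//].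
        split=> //=; rewrite lt_neqAle; apply/andP; split; first exact/eqP.
        by case: It => _; exact: ub_le_sup.
      by apply: measurable_lebR; exact: measurable_set1.
    pose G n := A `&` [set s : lebR R | (s : R) < y - n.+1%:R^-1].
    apply: (@le_trans _ _ (leb (\bigcup_n G n))).
      apply: le_measure; rewrite ?inE; first exact: measurableI.
        by apply: bigcupT_measurable => n; exact: measurableI.
      move=> t [[At _] /= ty].
      have ty' : 0 < y - t by rewrite subr_gt0.
      have [n _ /(_ n (leqnn n))/= nt] := near_infty_natSinv_lt (PosNum ty').
      by exists n => //; split => //=; rewrite ltrBrDl -ltrBrDr.
    apply: nondecreasing_measure_le => [n|m n mn t [At /= tm]|n].
    - exact: measurableI.
    - split => //=; apply: (lt_le_trans tm).
      by rewrite lerD2l lerN2 lef_pV2 ?posrE// ler_nat.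
    - by apply: ltJ; rewrite gtrBl.
  have geI : (x%:E <= leb I)%E.
    apply/lee_addgt0Pr => e e0.
    have ye : y < y + e by rewrite ltrDl.
    apply: ltW; apply: (lt_le_trans (gtJ _ ye)).
    have -> : e%:E = leb ([set` `[y, y + e[] : set (lebR R)).
      by rewrite leb_itv/= lte_fin ye -EFinB addrAC subrr add0r.
    apply: le_trans (measureU2 _ _ _); last 2 first.
      exact: mI.
      exact: measurable_lebR_itv.
    apply: le_measure; rewrite ?inE; first exact: measurableI.
      by apply: measurableU => //; exact: measurable_lebR_itv.
    move=> t [At /= te]; have [yt|ty] := leP y t; last by left; split => //; exact: ltJ.
    by right; rewrite /= in_itv/= yt te.
  have Ix : leb I = x%:E by apply/eqP; rewrite eq_le leI geI.
  by rewrite Ix min_r// -Ix.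
have JT t : (F t <= x%:E)%E.
  apply: contrapT => Ft; apply: nubJ; exists t => s /= Fs.
  by rewrite leNgt; apply/negP => /ltW /left_mass_le ts; apply: Ft; exact: le_trans Fs.
have -> : I = A by apply/seteqP; split => [t []|t At]; last by split => //; exact: JT.
rewrite min_l//; pose G (n : nat) := A `&` [set s : lebR R | (s : R) < n%:R].
apply: (@le_trans _ _ (leb (\bigcup_n G n))).
  apply: le_measure; rewrite ?inE//.
    by apply: bigcupT_measurable => n; exact: measurableI.
  by move=> t At; exists (Num.truncn (t : R)).+1 => //; split => //=; rewrite truncnS_gt.
apply: nondecreasing_measure_le => [n|m n mn t [At /= tm]|n].
- exact: measurableI.
- by split => //=; apply: (lt_le_trans tm); rewrite ler_nat.
- exact: JT.
Qed.

End InitialSegment.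
End Slicing.

Section LeftLimit.
Context {R : realType}.
Variable alpha : \bar R.
Implicit Types f : lebR R -> R[i].
Local Notation mr := (mu_real alpha).

(** For [x = +oo] this is the limit of the rearrangement at infinity. *)
Definition mu_left f (x : \bar R) : R :=
  inf [set mr f r | r in [set r : R | 0 < r /\ (r%:E < x)%E]].

Let lb f x : has_lbound [set mr f r | r in [set r : R | 0 < r /\ (r%:E < x)%E]].
Proof. by exists 0 => _ [r _ <-]; exact: mu_real_ge0. Qed.

Lemma mu_left_le f x r : 0 < r -> (r%:E < x)%E -> mu_left f x <= mr f r.
Proof. by move=> r0 rx; apply: (ge_inf (lb f x)); exists r. Qed.

Lemma ereal_gt0_between (x : \bar R) : (0 < x)%E ->
  exists r : R, 0 < r /\ (r%:E < x)%E.
Proof.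
case: x => [x| |] //; last by move=> _; exists 1; rewrite ltry.
by rewrite lte_fin => x0; exists (x / 2); rewrite lte_fin; split; lra.
Qed.

Let ne f x : (0 < x)%E ->
  [set mr f r | r in [set r : R | 0 < r /\ (r%:E < x)%E]] !=set0.
Proof. by move=> /ereal_gt0_between[r H]; exists (mr f r); exists r. Qed.

Lemma le_mu_left f x b : (0 < x)%E ->
  (forall r, 0 < r -> (r%:E < x)%E -> b <= mr f r) -> b <= mu_left f x.
Proof.
move=> x0 H; apply: lb_le_inf; first exact: ne.
by move=> _ [r [r0 rx] <-]; exact: H.
Qed.

Lemma mu_left_lt f x b : (0 < x)%E -> mu_left f x < b ->
  exists r, [/\ 0 < r, (r%:E < x)%E & mr f r < b].
Proof.
by move=> x0 /(inf_lt (ne f x0))[_ [r [r0 rx] <-] rb]; exists r.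
Qed.

Lemma mu_left_ge0 f x : 0 <= mu_left f x.
Proof.
have [/(ne f) h|x0] := ltP 0%E x.
  by apply: lb_le_inf => // _ [r _ <-]; exact: mu_real_ge0.
rewrite /mu_left (_ : image _ _ = set0) ?inf0//.
apply/seteqP; split => // y [r [r0 rx] _].
by have := lt_le_trans rx x0; rewrite lte_fin ltNge ltW.
Qed.

End LeftLimit.

Section Rank.
Context {R : realType}.
Variable alpha : \bar R.
Hypothesis alpha_gt0 : (0 < alpha)%E.
Local Notation D := (dom alpha).
Local Notation dist := (Defs.distribution alpha).
Local Notation mr := (mu_real alpha).
Local Notation ml := (mu_left alpha).
Local Notation finr := (finite_rearrangement alpha).

(** A level [s] is below the limit of the rearrangement at infinity exactly when
    [distribution f s = +oo]; see [above_limitP]. *)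
Definition above_limit (f : lebR R -> R[i]) :=
  forall s, 0 <= s -> dist f s = +oo%E ->
    {ae leb, forall t : lebR R, D t -> s <= modulus f t}.

Variable f : lebR R -> R[i].
Hypotheses (mf : L0 alpha f) (ff : finr f).
Local Notation g := (modulus f).

Definition level (v : R) : set (lebR R) := D `&` [set t | g t = v].

(** The measure of the set of points that come before [t] when [D] is ordered by
    decreasing modulus, and from left to right on each level set. *)
Definition rank (t : lebR R) : \bar R :=
  (dist f (g t) + left_mass (level (g t)) t)%E.

Let mD : measurable D. Proof. exact: measurable_dom. Qed.

Lemma measurable_level v : measurable (level v).
Proof.
have := measurable_modulus mf mD (measurable_set1 v).
by congr measurable; apply/seteqP; split => t.
Qed.

Lemma level_ge0 v t : level v t -> 0 <= (t : R). Proof. by case=> -[]. Qed.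

Lemma measurable_superlevel_ge v :
  measurable [set t : lebR R | D t /\ v <= g t].
Proof.
have := measurable_modulus mf mD (measurable_itv `[v, +oo[).
by congr measurable; apply/seteqP; split => t /=; rewrite in_itv/= andbT => -[].
Qed.

Let mlt := @measurable_left R.

Lemma leb_superlevel_ge v :
  leb [set t : lebR R | D t /\ v <= g t] = (dist f v + leb (level v))%E.
Proof.
rewrite /Defs.distribution -measureU//=.
- congr leb; apply/seteqP; split => t /=.
    by move=> [Dt]; rewrite le_eqVlt => /predU1P[->|]; [right|left].
  by move=> [[Dt /ltW]|[Dt <-]].
- exact: measurable_superlevel.
- exact: measurable_level.
- by apply/seteqP; split => t //= -[[_ vt] [_ tv]]; move: vt; rewrite tv ltxx.
Qed.

Lemma left_mass_le_level v t : (left_mass (level v) t <= leb (level v))%E.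
Proof.
apply: le_measure; last exact: subIsetl.
  by rewrite inE; apply: measurableI => //; exact: measurable_level.
by rewrite inE; exact: measurable_level.
Qed.

Lemma left_mass_ge0 (A : set (lebR R)) t : (0 <= left_mass A t)%E.
Proof. exact: measure_ge0. Qed.

Lemma rank_le_superlevel t : (rank t <= leb [set s : lebR R | D s /\ (g t <= g s)%R])%E.
Proof. by rewrite leb_superlevel_ge leeD2l// left_mass_le_level. Qed.

Lemma rank_le_alpha t : (rank t <= alpha)%E.
Proof.
apply: le_trans (rank_le_superlevel t) _; rewrite -[leRHS](leb_dom alpha_gt0).
by apply: le_measure; rewrite ?inE//; [exact: measurable_superlevel_ge|move=> s []].
Qed.

Lemma rank_gt_level x t : 0 < x -> mr f x < g t -> (rank t <= x%:E)%E.
Proof.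
move=> x0 vt; have [s /andP[vs st]] : exists s, mr f x < s < g t.
  by exists ((mr f x + g t) / 2); apply/andP; split; lra.
have s0 : 0 <= s by rewrite (le_trans _ (ltW vs))// mu_real_ge0.
apply: (@le_trans _ _ (dist f s)); last by rewrite -(mu_real_le mf ff)// ltW.
apply: le_trans (rank_le_superlevel t) _.
apply: le_measure; rewrite ?inE.
- exact: measurable_superlevel_ge.
- exact: measurable_superlevel.
- by move=> u /= [Du tu]; split => //; exact: lt_le_trans tu.
Qed.

Lemma rank_lt_level x t : 0 < x -> g t < mr f x -> (x%:E < rank t)%E.
Proof.
move=> x0; rewrite (mu_real_gt mf ff)// ?modulus_ge0// => /lt_le_trans; apply.
by rewrite leeDl// left_mass_ge0.
Qed.

(** The level of [|f|] at which the rank reaches [x] is the value of the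
    rearrangement at [x]. *)
Lemma rank_sublevelE x : 0 < x ->
  [set t | D t /\ (rank t <= x%:E)%E] =
  [set t | D t /\ mr f x < g t] `|`
  (level (mr f x) `&`
    [set t | (left_mass (level (mr f x)) t <= x%:E - dist f (mr f x))%E]).
Proof.
move=> x0; have dx : (dist f (mr f x) <= x%:E)%E.
  by rewrite -mu_real_le// mu_real_ge0.
have dfin : dist f (mr f x) \is a fin_num.
  by rewrite ge0_fin_numE ?dist_ge0// (le_lt_trans dx)// ltry.
apply/seteqP; split => t /=.
  move=> [Dt tx]; have [lt|gt|e] := ltgtP (mr f x) (g t).
  - by left.
  - by have := lt_le_trans (rank_lt_level x0 gt) tx; rewrite ltxx.
  - right; split => //; move: tx; rewrite /rank -e.
    by rewrite leeBrDl.
move=> [[Dt lt]|[[Dt /= e] tx]]; split => //; first exact: rank_gt_level.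
by rewrite /rank e; move: tx; rewrite leeBrDl.
Qed.

Lemma measurable_rank_le x : 0 < x ->
  measurable [set t | D t /\ (rank t <= x%:E)%E].
Proof.
move=> x0; rewrite rank_sublevelE//; apply: measurableU.
  exact: measurable_superlevel.
by apply: measurable_initial; exact: measurable_level.
Qed.

Lemma leb_rank_min x : 0 < x ->
  leb [set t | D t /\ (rank t <= x%:E)%E] =
  Order.min (leb [set t : lebR R | D t /\ (mr f x <= g t)%R]) x%:E.
Proof.
move=> x0; have dx : (dist f (mr f x) <= x%:E)%E.
  by rewrite -mu_real_le// mu_real_ge0.
have dfin : dist f (mr f x) \is a fin_num.
  by rewrite ge0_fin_numE ?dist_ge0// (le_lt_trans dx)// ltry.
have yfin : (x%:E - dist f (mr f x))%E \is a fin_num.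
  by rewrite fin_numB/= dfin.
rewrite rank_sublevelE// -(fineK yfin) measureU//=; last 3 first.
- exact: measurable_superlevel.
- by apply: measurable_initial; exact: measurable_level.
- by apply/seteqP; split => t //= -[[_ vt] [[_ tv] _]]; move: vt; rewrite tv ltxx.
rewrite leb_initial; last 3 first.
- exact: measurable_level.
- exact: level_ge0.
- by apply: fine_ge0; rewrite sube_ge0// dfin orbT.
rewrite -[X in (X + _)%E]/(dist f (mr f x)) leb_superlevel_ge fineK//.
by rewrite !minEle leeBrDl//; case: ifP => // _; rewrite addeC subeK.
Qed.

Lemma leb_rank_le x : 0 < x -> (leb [set t | D t /\ (rank t <= x%:E)%E] <= x%:E)%E.
Proof. by move=> x0; rewrite leb_rank_min// ge_min lexx orbT. Qed.

Section AboveLimit.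
Hypothesis fa : above_limit f.

(** Below that value the superlevel sets have measure more than [x]. If these
    measures are finite they pass to the limit; if not, [|f|] is almost everywhere
    at least the value by [above_limit]. *)
Lemma superlevel_mu_real_ge x : 0 < x -> (x%:E < alpha)%E ->
  (x%:E <= leb [set t : lebR R | D t /\ (mr f x <= g t)%R])%E.
Proof.
move=> x0 xa; set v := mr f x.
have alpha_le : {ae leb, forall t : lebR R, D t -> v <= g t} ->
    (x%:E <= leb [set t : lebR R | D t /\ (v <= g t)%R])%E.
  move=> ae_v; rewrite (le_trans (ltW xa))// -[leLHS](leb_dom alpha_gt0).
  apply: ae_le_measure => //; first exact: measurable_superlevel_ge.
  by apply: filterS ae_v => t vt Dt; split => //; exact: vt.
have [v0|v0] := leP v 0.
  by apply: alpha_le; apply: aeW => t _; rewrite (le_trans v0)// modulus_ge0.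
have [[v' [v'0 v'v dv']]|H] :=
    pselect (exists v', [/\ 0 <= v', v' < v & (dist f v' < +oo)%E]).
  pose w n := Num.max v' (v - n.+1%:R^-1).
  have wv n : w n < v by rewrite gt_max v'v/= gtrBl.
  have w0 n : 0 <= w n by rewrite le_max v'0.
  pose G n := [set t | D t /\ w n < g t].
  have GE : [set t : lebR R | D t /\ v <= g t] = \bigcap_n G n.
    apply/seteqP; split => t /=.
      by move=> [Dt vt] n _; split => //; exact: lt_le_trans vt.
    move=> H; split; first by case: (H 0%N I).
    rewrite leNgt; apply/negP => tv.
    have tv' : 0 < v - g t by rewrite subr_gt0.
    have [n _ /(_ n (leqnn n))/= nt] := near_infty_natSinv_lt (PosNum tv').
    have [_] := H n I; rewrite gt_max => /andP[_].
    by rewrite ltNge ltW// ltrBrDl -ltrBrDr.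
  have mG n : measurable (G n) by exact: measurable_superlevel.
  have G0 : (leb (G 0%N) < +oo)%E.
    by apply: le_lt_trans dv'; apply: dist_le => //; rewrite le_max lexx.
  have niG : {homo G : n m / (n <= m)%N >-> (m <= n)%O}.
    move=> n m nm; apply/subsetPset => t [Dt mt]; split => //.
    apply: le_lt_trans mt; rewrite ge_max le_max lexx/= le_max.
    by rewrite lerD2l lerN2 lef_pV2 ?posrE// ler_nat ltnS nm orbT.
  have C := nonincreasing_cvg_mu (mu := leb) G0 mG (bigcapT_measurable mG) niG.
  rewrite GE -(cvg_lim _ C)//; apply: lime_ge.
    by apply/cvg_ex; eexists; exact: C.
  by apply: nearW => n; rewrite ltW// -/(dist f (w n)) -(mu_real_gt mf ff).
apply: alpha_le.
have : {ae leb, forall t n, D t -> Num.max 0 (v - n.+1%:R^-1) <= g t}.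
  apply: ae_foralln => n; apply: fa; first by rewrite le_max lexx.
  apply/eqP; rewrite -leye_eq leNgt; apply/negP => dn; apply: H.
  exists (Num.max 0 (v - n.+1%:R^-1)); split => //; first by rewrite le_max lexx.
  by rewrite gt_max v0/= gtrBl.
apply: filterS => t H' Dt; rewrite leNgt; apply/negP => tv.
have tv' : 0 < v - g t by rewrite subr_gt0.
have [n _ /(_ n (leqnn n))/= nt] := near_infty_natSinv_lt (PosNum tv').
have := H' n Dt; rewrite ge_max => /andP[_].
by rewrite leNgt ltrBrDl -ltrBrDr nt.
Qed.

(** Hence the rank preserves measure, with image [[0, alpha)]. *)
Lemma leb_rank x : 0 < x -> (x%:E < alpha)%E ->
  leb [set t | D t /\ (rank t <= x%:E)%E] = x%:E.
Proof. by move=> x0 xa; rewrite leb_rank_min// min_r// superlevel_mu_real_ge. Qed.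

End AboveLimit.
End Rank.

Section Negligible.
Context d (T : measurableType d) {R : realType}.
Variable mu : {measure set T -> \bar R}.

Lemma negligible_small (N : set T) :
  (forall e : R, 0 < e -> exists B, [/\ measurable B, N `<=` B & (mu B <= e%:E)%E]) ->
  mu.-negligible N.
Proof.
move=> H.
have inv0 n : 0 < n.+1%:R^-1 :> R by rewrite invr_gt0.
pose B n := projT1 (cid (H _ (inv0 n))).
have BP n : [/\ measurable (B n), N `<=` B n & (mu (B n) <= n.+1%:R^-1%:E)%E].
  by rewrite /B; case: cid.
have mB : measurable (\bigcap_n B n).
  by apply: bigcapT_measurable => n; have [] := BP n.
exists (\bigcap_n B n); split => //; last first.
  by move=> t Nt n _; have [_ + _] := BP n; exact.
apply/eqP; rewrite -measure_le0; apply/lee_addgt0Pr => e e0; rewrite add0e.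
have [n _ /(_ n (leqnn n))/= ne] := near_infty_natSinv_lt (PosNum e0).
apply: (@le_trans _ _ n.+1%:R^-1%:E); last by rewrite lee_fin ltW.
have [mBn _] := BP n; apply: le_trans; apply: le_measure; rewrite ?inE//.
exact: bigcap_inf.
Qed.

End Negligible.

Section MeasurableSublevel.
Context d (S : measurableType d) {R : realType}.

Lemma measurable_fun_sublevel (U : set S) (h : S -> R) :
  (forall y, measurable (U `&` [set t | h t < y])) -> measurable_fun U h.
Proof.
move=> mh; apply: (measurability _ (@RGenInftyO.measurableE R)).
move=> _ [_ [y ->] <-].
have -> : h @^-1` `]-oo, y[ = [set t | h t < y].
  by apply/seteqP; split => t /=; rewrite in_itv/=.
exact: mh.
Qed.

End MeasurableSublevel.

Section RankTransfer.
Context {R : realType}.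
Variable alpha : \bar R.
Hypothesis alpha_gt0 : (0 < alpha)%E.
Local Notation D := (dom alpha).
Local Notation dist := (Defs.distribution alpha).
Local Notation mr := (mu_real alpha).
Local Notation ml := (mu_left alpha).
Local Notation finr := (finite_rearrangement alpha).
Local Notation rearr := (rearrangement alpha).

Variable f : lebR R -> R[i].
Hypotheses (mf : L0 alpha f) (ff : finr f).
Local Notation rk := (rank alpha f).

Let mD : measurable D. Proof. exact: measurable_dom. Qed.

Lemma rank_gt0_ae : {ae leb, forall t, D t -> (0 < rk t)%E}.
Proof.
apply: negligible_small => e e0.
exists [set t | D t /\ (rk t <= e%:E)%E]; split.
- exact: measurable_rank_le.
- move=> t /= /not_implyP[Dt /negP]; rewrite -leNgt => r0; split => //.
  by rewrite (le_trans r0)// lee_fin ltW.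
- exact: leb_rank_le.
Qed.

(** [mu_left u (rank t)] exceeds [s] only where [rank t] is at most
    [distribution u s], and by [leb_rank_le] no more points than that have such a
    rank. *)
Lemma rearr_rank_le u F : L0 alpha u -> finr u -> L0 alpha F ->
  (forall t, D t -> modulus F t = ml u (rk t)) ->
  forall t, (rearr F t <= rearr u t)%E.
Proof.
move=> mu fu mF FE t; apply: le_ereal_inf_tmp => _ [s [s0 st] <-].
apply: ereal_inf_lbound; exists s => //; split => //; apply: le_trans st.
have [au|ua] := leP alpha (dist u s).
  by apply: le_trans au; exact: dist_le_alpha.
have dfin : dist u s \is a fin_num.
  by rewrite ge0_fin_numE ?dist_ge0// (lt_le_trans ua)// leey.
apply/lee_addgt0Pr => e e0; rewrite -(fineK dfin) -EFinD.
set x := fine _ + e; have x0 : 0 < x by rewrite ltr_wpDl// fine_ge0// dist_ge0.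
apply: le_trans (leb_rank_le mf ff x0); apply: le_measure; rewrite ?inE.
- exact: measurable_superlevel.
- exact: measurable_rank_le.
move=> r /= [Dr]; rewrite FE// => sr; split => //.
rewrite leNgt; apply/negP => xr; move: sr; rewrite ltNge => /negP; apply.
apply: le_trans (mu_left_le alpha u x0 xr) _.
rewrite mu_real_le//; last exact: ltW.
by rewrite -(fineK dfin) lee_fin lerDl ltW.
Qed.

Lemma measurable_mu_left_rank u : L0 alpha u -> finr u ->
  measurable_fun D (fun t => ml u (rk t)).
Proof.
move=> mu fu; apply: measurable_fun_sublevel => b.
pose Z := \bigcap_n [set t | D t /\ (rk t <= (n.+1%:R^-1 : R)%:E)%E].
pose Q (q : rat) : set (lebR R) :=
  if (0 < ratr q :> R) && (mr u (ratr q) < b)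
  then D `\` [set t | D t /\ (rk t <= (ratr q : R)%:E)%E] else set0.
have mZ : measurable Z.
  by apply: bigcapT_measurable => n; apply: measurable_rank_le => //; rewrite invr_gt0.
have mQ q : measurable (Q q).
  rewrite /Q; case: ifP => [/andP[q0 _]|_]; last exact: measurable0.
  by apply: measurableD => //; exact: measurable_rank_le.
have ZE t : Z t <-> D t /\ (rk t <= 0)%E.
  split=> [H|[Dt r0] n _]; last first.
    by split => //; rewrite (le_trans r0)// lee_fin invr_ge0.
  split; first by have [] := H 0%N I.
  apply/lee_addgt0Pr => e e0; rewrite add0e.
  have [n _ /(_ n (leqnn n))/= ne] := near_infty_natSinv_lt (PosNum e0).
  by have [_ /le_trans] := H n I; apply; rewrite lee_fin ltW.
have ml0 t : (rk t <= 0)%E -> ml u (rk t) = 0.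
  move=> r0; rewrite /mu_left (_ : image _ _ = set0) ?inf0//.
  apply/seteqP; split => // y [r [r1 rx] _].
  by have := lt_le_trans rx r0; rewrite lte_fin ltNge ltW.
rewrite (_ : _ `&` _ = (if 0 < b then Z else set0) `|` \bigcup_q Q q).
  apply: measurableU; first by case: ifP.
  exact: countable_bigcupT_measurable.
apply/seteqP; split => t /=.
  move=> [Dt tb]; have [r0|r0] := leP (rk t) 0%E.
    by left; rewrite -(ml0 _ r0) tb; apply/ZE.
  right; have [r [r1 rx rb]] := mu_left_lt r0 tb.
  have [r' [rr' r'x]] : exists r', r < r' /\ (r'%:E < rk t)%E.
    case: (rk t) rx => [x| |] //; last by exists (r + 1); rewrite ltry; split => //; lra.
    by rewrite lte_fin => rx; exists ((r + x) / 2); rewrite lte_fin; split; lra.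
  have [q] := rat_in_itvoo rr'; rewrite in_itv/= => /andP[rq qr'].
  exists q => //; rewrite /Q (lt_trans r1 rq)/=.
  rewrite (le_lt_trans _ rb); last by apply: mu_real_noninc => //; exact: ltW.
  split => // -[_]; apply/negP; rewrite -ltNge; apply: lt_trans r'x.
  by rewrite lte_fin.
move=> [|[q _]].
  case: ifP => // b0 /ZE[Dt r0]; split => //; by rewrite ml0.
rewrite /Q; case: ifP => // /andP[q0 qb] [Dt nr]; split => //.
apply: le_lt_trans qb; apply: mu_left_le => //; rewrite ltNge; apply/negP => H.
by apply: nr.
Qed.

Hypothesis fa : above_limit alpha f.

(** The points of rank [x] are, for every [y < x], among those of rank in
    []y, x]], a set of measure at most [x - y]. *)
Lemma rank_neq_ae (x : R) : {ae leb, forall t, D t -> rk t <> x%:E}.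
Proof.
have [x0|x0] := leP x 0.
  apply: filterS rank_gt0_ae => t H Dt e; move: (H Dt).
  by rewrite e lte_fin ltNge x0.
have [xa|ax] := leP x%:E alpha; last first.
  apply: aeW => t Dt e; move: ax; rewrite -e ltNge.
  by rewrite (rank_le_alpha alpha_gt0 mf).
apply: negligible_small => e e0; pose y := Num.max (x - e) (x / 2).
have y0 : 0 < y by rewrite lt_max divr_gt0// orbT.
have yx : y < x by rewrite gt_max; apply/andP; split; lra.
have ya : (y%:E < alpha)%E by apply: lt_le_trans xa; rewrite lte_fin.
exists ([set t | D t /\ (rk t <= x%:E)%E] `\` [set t | D t /\ (rk t <= y%:E)%E]).
split.
- by apply: measurableD; exact: measurable_rank_le.
- move=> t /= /not_implyP[Dt /contrapT ->]; split => // -[_].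
  by rewrite lee_fin leNgt yx.
- rewrite measureD/=; last 3 first.
  + exact: measurable_rank_le.
  + exact: measurable_rank_le.
  + by apply: le_lt_trans (leb_rank_le _ _ _) _ => //; rewrite ltry.
  rewrite setIidr; last first.
    by move=> t [Dt ty]; split => //; rewrite (le_trans ty)// lee_fin ltW.
  rewrite (leb_rank alpha_gt0 mf ff fa y0 ya).
  apply: le_trans (leeB (leb_rank_le mf ff x0) (le_refl _)) _.
  by rewrite -EFinB lee_fin lerBlDr -lerBlDl le_max lexx.
Qed.

Lemma ae_forall_rat (P : rat -> lebR R -> Prop) :
  (forall q, {ae leb, forall t, P q t}) -> {ae leb, forall t, forall q, P q t}.
Proof.
move=> H; have : {ae leb, forall t (n : nat),
    if unpickle n is Some q then P q t else True}.
  by apply: ae_foralln => n; case: unpickle => [q|]; [exact: H|exact: aeW].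
by apply: filterS => t Ht q; have := Ht (pickle q); rewrite pickleK.
Qed.

(** The rank avoids almost everywhere the countably many values
    [distribution f q] with [q] rational, hence is a point of continuity of the
    rearrangement of [f]; an infinite rank is where [above_limit] is needed. *)
Lemma modulus_rank : {ae leb, forall t, D t -> modulus f t = ml f (rk t)}.
Proof.
have r0 := rank_gt0_ae.
have rn : {ae leb, forall t (q : rat), 0 <= (ratr q : R) -> D t ->
      if dist f (ratr q) is x%:E then rk t <> x%:E else ratr q <= modulus f t}.
  apply: ae_forall_rat => q; have [q0|q0] := leP 0 (ratr q : R); last first.
    by apply: aeW => t; rewrite leNgt.
  move: (@fa _ q0) (dist_ge0 alpha f (ratr q)).
  case: (dist f (ratr q)) => [x| |] // H _.
    by apply: filterS (rank_neq_ae x) => t H' _; exact: H'.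
  by apply: filterS (H erefl) => t H' _; exact: H'.
apply: filterS2 r0 rn => t r0 rn Dt; have {}r0 := r0 Dt.
apply/eqP; rewrite eq_le; apply/andP; split.
  apply: le_mu_left => // r r1 rx; rewrite leNgt; apply/negP => lt.
  by have := rank_gt_level mf ff r1 lt; rewrite leNgt rx.
rewrite leNgt; apply/negP => lt.
have [q] := rat_in_itvoo lt; rewrite in_itv/= => /andP[tq ql].
have q0 : 0 <= (ratr q : R) by rewrite (le_trans (modulus_ge0 f t))// ltW.
have dq : (dist f (ratr q) <= rk t)%E.
  apply: (@le_trans _ _ (dist f (modulus f t))).
    by apply: dist_le => //; exact: ltW.
  by rewrite leeDl// left_mass_ge0.
have rq : (rk t <= dist f (ratr q))%E.
  rewrite leNgt; apply/negP => dr.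
  have [r [r1 dr' rr]] : exists r, [/\ 0 < r, (dist f (ratr q) <= r%:E)%E &
      (r%:E < rk t)%E].
    move: dr (dist_ge0 alpha f (ratr q)); case: (dist f (ratr q)) => [x| |] //; last first.
      by rewrite ltNge leey.
    case: (rk t) r0 => [y| |] y0 xy x0 //.
      exists ((x + y) / 2); rewrite lee_fin !lte_fin in x0 xy y0 *.
      by rewrite lee_fin; split; lra.
    exists (x + 1); rewrite lee_fin ltry; split => //; last by lra.
    by rewrite lee_fin in x0; lra.
  have := lt_le_trans ql (mu_left_le alpha f r1 rr).
  by rewrite mu_real_gt// ltNge dr'.
have := rn q q0 Dt; have e : rk t = dist f (ratr q) by apply/eqP; rewrite eq_le rq dq.
move: e r0; case: (dist f (ratr q)) => [x|_ _|-> //] //.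
by rewrite leNgt tq.
Qed.

End RankTransfer.

(** * Linear relations between rearrangements *)

Section LeftLimitFamilies.
Context {R : realType}.
Variable alpha : \bar R.
Implicit Types u : lebR R -> R[i].
Local Notation mr := (mu_real alpha).
Local Notation ml := (mu_left alpha).

Lemma mu_left_approx u (x : \bar R) e : (0 < x)%E -> 0 < e ->
  exists r : R, [/\ 0 < r, (r%:E < x)%E & forall y : \bar R, (r%:E < y)%E ->
    (y <= x)%E -> `|ml u y - ml u x| < e].
Proof.
move=> x0 e0; have [|r [r0 rx re]] := @mu_left_lt _ alpha u x (ml u x + e) x0.
  by rewrite ltrDl.
exists r; split => // y ry yx.
have y0 : (0 < y)%E by apply: lt_trans ry; rewrite lte_fin.
have h1 : ml u x <= ml u y.
  by apply: le_mu_left => // s s0 sy; apply: mu_left_le => //; exact: lt_le_trans yx.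
have h2 : ml u y <= mr u r by exact: mu_left_le.
by rewrite ger0_norm ?subr_ge0//; lra.
Qed.

Lemma common_left_nbhs n (x : \bar R) (Q : 'I_n -> \bar R -> Prop) : (0 < x)%E ->
  (forall i, exists r : R, [/\ 0 < r, (r%:E < x)%E & forall y : \bar R,
     (r%:E < y)%E -> (y <= x)%E -> Q i y]) ->
  exists r : R, [/\ 0 < r, (r%:E < x)%E & forall y : \bar R,
     (r%:E < y)%E -> (y <= x)%E -> forall i, Q i y].
Proof.
move=> x0 H.
suff [r [r0 rx rP]] : exists r : R, [/\ 0 < r, (r%:E < x)%E & forall y : \bar R,
     (r%:E < y)%E -> (y <= x)%E -> forall i, i \in enum 'I_n -> Q i y].
  by exists r; split => // y ry yx i; apply: rP => //; rewrite mem_enum.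
elim: (enum 'I_n) => [|i s [r [r0 rx rP]]].
  by have [r [r0 rx]] := ereal_gt0_between x0; exists r; split.
have [r' [r'0 r'x r'P]] := H i; exists (Num.max r r'); split.
- by rewrite lt_max r0.
- by rewrite EFin_max gt_max rx r'x.
- move=> y; rewrite EFin_max gt_max => /andP[ry r'y] yx j.
  by rewrite inE => /predU1P[->|js]; [exact: r'P|exact: rP].
Qed.

End LeftLimitFamilies.

Lemma normcR (R : rcfType) (x : R) : `|x%:C| = (`|x|)%:C :> R[i].
Proof. by rewrite normc_def/= expr0n/= addr0 sqrtr_sqr. Qed.

Section RankLinear.
Context {R : realType}.
Variable alpha : \bar R.
Hypothesis alpha_gt0 : (0 < alpha)%E.
Local Notation D := (dom alpha).
Local Notation ml := (mu_left alpha).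
Local Notation finr := (finite_rearrangement alpha).

Variable f : lebR R -> R[i].
Hypotheses (mf : L0 alpha f) (ff : finr f) (fa : above_limit alpha f).
Local Notation rk := (rank alpha f).

(** The rank visits every interval of [[0, alpha)] on a set of positive measure, and
    [mu_left] is left-continuous. *)
Lemma linear_relation_of_rank n (c : 'I_n -> R[i]) (u : 'I_n -> lebR R -> R[i]) :
  {ae leb, forall t, D t -> \sum_(i < n) c i * (ml (u i) (rk t))%:C = 0} ->
  forall x, (0 < x)%E -> (x <= alpha)%E -> \sum_(i < n) c i * (ml (u i) x)%:C = 0.
Proof.
move=> H x x0 xa; apply/eqP/negPn/negP => S0.
pose S y := \sum_(i < n) c i * (ml (u i) y)%:C; rewrite -/(S x) in S0.
pose nc (z : R[i]) : R := ComplexField.Normc.normc z.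
have ncE z : `|z| = (nc z)%:C by [].
have N0 : 0 < nc (S x) by rewrite -ltcR -ncE normr_gt0.
have nc0 z : 0 <= nc z by rewrite -lecR -ncE normr_ge0.
pose M := \sum_(i < n) nc (c i).
have M0 : 0 <= M by rewrite sumr_ge0.
pose e := nc (S x) / (M + 1).
have e0 : 0 < e by rewrite divr_gt0// ltr_wpDl.
have [r [r0 rx rP]] := common_left_nbhs x0 (fun i => mu_left_approx alpha (u i) x0 e0).
have Sn0 (y : \bar R) : (r%:E < y)%E -> (y <= x)%E -> S y <> 0.
  move=> ry yx Sy; suff : nc (S x) <= M * e.
    rewrite /e mulrA ler_pdivlMr ?ltr_wpDl// mulrDr mulr1 mulrC.
    by rewrite gerDl leNgt N0.
  rewrite -lecR -ncE -normrN -[- S x]add0r -Sy /S -sumrB.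
  apply: le_trans (ler_norm_sum _ _ _) _.
  rewrite /M mulr_suml rmorph_sum/=; apply: ler_sum => i _.
  rewrite -mulrBr -rmorphB/= normrM ncE rmorphM/= ler_wpM2l//.
    by rewrite lecR.
  by rewrite normcR lecR ltW// rP.
have [r' [rr' r'x]] : exists r', r < r' /\ (r'%:E < x)%E.
  case: x rx {x0 xa S0 N0 e e0 rP Sn0} => [x| |] rx //.
    by exists ((r + x) / 2); rewrite !lte_fin in rx *; split; lra.
  by exists (r + 1); rewrite ltry; split => //; lra.
have r'a := lt_le_trans r'x xa; have r'0 := lt_trans r0 rr'.
have ra : (r%:E < alpha)%E by apply: lt_trans r'a; rewrite lte_fin.
suff : (r'%:E <= r%:E)%E by rewrite lee_fin leNgt rr'.
rewrite -(leb_rank alpha_gt0 mf ff fa r'0 r'a) -(leb_rank alpha_gt0 mf ff fa r0 ra).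
apply: ae_le_measure; try exact: measurable_rank_le.
apply: filterS H => t H [Dt tr']; split => //.
rewrite leNgt; apply/negP => rt; apply: (Sn0 (rk t)) => //; last exact: H.
by rewrite (le_trans tr')// ltW.
Qed.

End RankLinear.

Section MassRelation.
Context {R : realType}.
Variable alpha : \bar R.
Implicit Types f u : lebR R -> R[i].
Local Notation mr := (mu_real alpha).
Local Notation ml := (mu_left alpha).
Local Notation K := (partial_mass alpha).
Local Notation finr := (finite_rearrangement alpha).

Lemma partial_mass_cat f a b : L0 alpha f -> finr f -> 0 < a -> a < b ->
  (K f a + ((b - a) * mr f b)%:E <= K f b)%E /\
  (K f b <= K f a + ((b - a) * mr f a)%:E)%E.
Proof.
move=> mf ff a0 ab.
have mab : measurable ([set` `[a, b[] : set (lebR R)) by exact: measurable_lebR_itv.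
have mr_ab : measurable_fun ([set` `[a, b[] : set (lebR R)) (EFin \o mr f : lebR R -> \bar R).
  apply/measurable_EFinP; apply: measurable_funS (measurable_mu_real mf ff).
    exact: measurable_lebR_itv.
  by move=> t /=; rewrite !in_itv/= andbT => /andP[/(lt_le_trans a0)].
have -> : K f b = (K f a + \int[leb]_(t in [set` `[a, b[]) (mr f t)%:E)%E.
  rewrite /partial_mass
    -(ge0_integral_setU leb (measurable_lebR_itv `]0, a[) mab).
  - congr (integral _ _ _); apply/seteqP; split => t /=; rewrite !in_itv/=.
      move=> /andP[t0 tb]; have [at'|ta] := leP a t; first by right; rewrite tb.
      by left; rewrite t0.
    move=> [/andP[-> /lt_trans ->//]|/andP[/(lt_le_trans a0) -> ->//]].
  - apply/measurable_EFinP.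
    apply: (measurable_funS (measurable_lebR_itv `]0, +oo[) _ (measurable_mu_real mf ff)).
    move=> t /= [|]; rewrite !in_itv/= andbT => /andP[//].
    by move=> /(lt_le_trans a0).
  - by move=> t _; rewrite lee_fin mu_real_ge0.
  - apply/disj_set2P/seteqP; split => t //=; rewrite !in_itv/=.
    by move=> [/andP[_ ta] /andP[]]; rewrite leNgt ta.
have lab : leb ([set` `[a, b[] : set (lebR R)) = (b - a)%:E.
  by rewrite leb_itv/= lte_fin ab -EFinB.
have cstE v : ((b - a) * v)%:E = (\int[leb]_(t in [set` `[a, b[]) (cst v%:E t))%E.
  by rewrite integral_cst//= lab mulrC EFinM.
rewrite !cstE; split; apply: leeD2l; apply: ge0_le_integral => //.
- by move=> t _; rewrite lee_fin mu_real_ge0.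
- move=> t /=; rewrite in_itv/= => /andP[at' tb].
  by rewrite lee_fin mu_real_noninc ?(lt_le_trans a0)// ltW.
- by move=> t _; rewrite lee_fin mu_real_ge0.
- move=> t /=; rewrite in_itv/= => /andP[at' tb].
  by rewrite lee_fin mu_real_noninc.
Qed.

(** On a short interval a monotone function is squeezed between the slopes of its
    primitive over neighbouring intervals; only its values at jumps are lost. *)
Lemma mu_left_mean n f (u : 'I_n -> lebR R -> R[i]) (w : R) : 0 <= w ->
  L0 alpha f -> finr f -> (forall i, L0 alpha (u i)) -> (forall i, finr (u i)) ->
  (forall i t, 0 < t -> (K (u i) t < +oo)%E) ->
  (forall t, 0 < t -> (t%:E < alpha)%E -> K f t = (w%:E * \sum_(i < n) K (u i) t)%E) ->
  forall x, (0 < x)%E -> (x <= alpha)%E ->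
    ml f x = w * \sum_(i < n) ml (u i) x.
Proof.
move=> w0 mf ff mu fu Ku KE x x0 xa.
pose psi t := w * \sum_(i < n) mr (u i) t.
have KufinN i t : 0 < t -> K (u i) t \is a fin_num.
  by move=> t0; rewrite ge0_fin_numE ?partial_mass_ge0// Ku.
pose kr i t := fine (K (u i) t).
pose kf t := w * \sum_(i < n) kr i t.
have KfE t : 0 < t -> (t%:E < alpha)%E -> K f t = (kf t)%:E.
  move=> t0 ta; rewrite KE// /kf EFinM -sumEFin; congr (_ * _)%E.
  by apply: eq_bigr => i _; rewrite fineK// KufinN.
have kr_cat i a b : 0 < a -> a < b ->
    kr i a + (b - a) * mr (u i) b <= kr i b <= kr i a + (b - a) * mr (u i) a.
  move=> a0 ab; have b0 := lt_trans a0 ab.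
  have [] := partial_mass_cat (mu i) (fu i) a0 ab.
  rewrite -(fineK (KufinN i a a0)) -(fineK (KufinN i b b0)) -!EFinD !lee_fin.
  by move=> -> ->.
have psi_cat a b : 0 < a -> a < b ->
    kf a + (b - a) * psi b <= kf b <= kf a + (b - a) * psi a.
  move=> a0 ab; rewrite /kf /psi ![(b - a) * _]mulrCA -!mulrDr ![(b - a) * \sum_(_ < _) _]mulr_sumr -!big_split/=.
  by apply/andP; split; apply: ler_wpM2l => //; apply: ler_sum => i _;
    have /andP[] := kr_cat i a b a0 ab.
have phi_psi a b : 0 < a -> a < b -> (b%:E < alpha)%E ->
    mr f b <= psi a /\ psi b <= mr f a.
  move=> a0 ab ba; have b0 := lt_trans a0 ab.
  have aa : (a%:E < alpha)%E by apply: lt_trans ba; rewrite lte_fin.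
  have [] := partial_mass_cat mf ff a0 ab; rewrite !KfE// -!EFinD !lee_fin => h1 h2.
  have /andP[h3 h4] := psi_cat a b a0 ab.
  have ba0 : 0 < b - a by rewrite subr_gt0.
  split; rewrite -(ler_pM2l ba0) -(lerD2l (kf a)).
    exact: le_trans h1 h4.
  exact: le_trans h3 h2.
have between (r : R) : (r%:E < x)%E -> exists s, r < s /\ (s%:E < x)%E.
  case: x {x0 xa} => [x| |] rx //.
    by exists ((r + x) / 2); rewrite !lte_fin in rx *; split; lra.
  by exists (r + 1); rewrite ltry; split => //; lra.
apply/eqP; rewrite eq_le; apply/andP; split.
  apply/ler_addgt0Pr => e e0.
  pose e' := e / (w * n%:R + 1).
  have d0 : 0 < w * n%:R + 1 by rewrite ltr_wpDl// mulr_ge0.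
  have e'0 : 0 < e' by rewrite divr_gt0.
  have [i|r [r0 rx rP]] := @common_left_nbhs _ n x
      (fun i y => forall s, s%:E = y -> mr (u i) s < ml (u i) x + e') x0.
    have [|r [r0 rx re]] := @mu_left_lt _ alpha (u i) x (ml (u i) x + e') x0.
      by rewrite ltrDl.
    exists r; split => // y + _ s sy; rewrite -sy lte_fin => rs.
    by apply: le_lt_trans re; apply: mu_real_noninc => //; exact: ltW.
  have [a [ra ax]] := between r rx; have [b [ab bx]] := between a ax.
  have a0 := lt_trans r0 ra.
  have [h _] := phi_psi a b a0 ab (lt_le_trans bx xa).
  apply: le_trans (mu_left_le alpha f (lt_trans a0 ab) bx) _.
  apply: (le_trans h); rewrite /psi.
  apply: (@le_trans _ _ (w * \sum_(i < n) (ml (u i) x + e'))).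
    apply: ler_wpM2l => //; apply: ler_sum => i _; apply: ltW.
    by apply: (rP a%:E) => //; exact: ltW.
  rewrite big_split/= mulrDr lerD2l sumr_const card_ord -mulr_natl mulrA /e'.
  rewrite mulrA ler_pdivrMr// mulrC ler_pM2l//; lra.
apply: le_mu_left => // a a0 ax; have [b [ab bx]] := between a ax.
have [_ h] := phi_psi a b a0 ab (lt_le_trans bx xa); apply: le_trans h.
apply: ler_wpM2l => //; apply: ler_sum => i _.
by apply: mu_left_le => //; exact: lt_trans ab.
Qed.

End MassRelation.

(** * Complex signs and measurability *)

Section ComplexSign.
Context {R : realType}.
Implicit Types z : R[i].
Local Notation nc := (@ComplexField.Normc.normc R).

Lemma norm_normc z : `|z| = (nc z)%:C. Proof. by []. Qed.

(** The value 1 at 0 makes the sign unimodular everywhere. *)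
Definition csign z : R[i] := if z == 0 then 1 else z / `|z|.

Lemma csignE z : z = csign z * (nc z)%:C.
Proof.
rewrite /csign; have [->|z0] := eqVneq z 0; last first.
  by rewrite -norm_normc divfK// normr_eq0.
by rewrite -norm_normc normr0 mulr0.
Qed.

Lemma norm_csign z : `|csign z| = 1.
Proof.
rewrite /csign; case: ifPn => [_|z0]; first by rewrite normr1.
by rewrite normrM normfV normr_id divff// normr_eq0.
Qed.

Lemma normc_mul z z' : nc (z * z') = nc z * nc z'.
Proof. by apply: complexI; rewrite rmorphM/= -!norm_normc normrM. Qed.

Lemma normc_csign z : nc (csign z) = 1.
Proof. by apply: complexI; rewrite -norm_normc norm_csign. Qed.

Lemma normc_real (x : R) : nc x%:C = `|x|.
Proof. by apply: complexI; rewrite -norm_normc normcR. Qed.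

End ComplexSign.

Section L0Closure.
Context {R : realType}.
Variable alpha : \bar R.
Local Notation D := (dom alpha).
Implicit Types f g : lebR R -> R[i].

Let mD : measurable D. Proof. exact: measurable_dom. Qed.

Lemma L0_cst (c : R[i]) : L0 alpha (fun _ => c).
Proof. by split; exact: measurable_cst. Qed.

Lemma L0_add f g : L0 alpha f -> L0 alpha g -> L0 alpha (fun t => f t + g t).
Proof.
move=> [f1 f2] [g1 g2]; split.
  rewrite (_ : (fun t => _) = (fun t => complex.Re (f t)) \+ (fun t => complex.Re (g t))).
    exact: measurable_funD.
  by apply/funext => t /=; case: (f t); case: (g t).
rewrite (_ : (fun t => _) = (fun t => complex.Im (f t)) \+ (fun t => complex.Im (g t))).
  exact: measurable_funD.
by apply/funext => t /=; case: (f t); case: (g t).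
Qed.

Lemma L0_mul f g : L0 alpha f -> L0 alpha g -> L0 alpha (fun t => f t * g t).
Proof.
move=> [f1 f2] [g1 g2]; split.
  rewrite (_ : (fun t => _) = ((fun t => complex.Re (f t)) \* (fun t => complex.Re (g t)))
    \- ((fun t => complex.Im (f t)) \* (fun t => complex.Im (g t)))).
    by apply: measurable_funB; exact: measurable_funM.
  by apply/funext => t /=; case: (f t); case: (g t).
rewrite (_ : (fun t => _) = ((fun t => complex.Re (f t)) \* (fun t => complex.Im (g t)))
    \+ ((fun t => complex.Im (f t)) \* (fun t => complex.Re (g t)))).
  by apply: measurable_funD; exact: measurable_funM.
by apply/funext => t /=; case: (f t); case: (g t).
Qed.

Lemma L0_real (h : lebR R -> R) : measurable_fun D h -> L0 alpha (fun t => (h t)%:C).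
Proof. by move=> mh; split => //; exact: measurable_cst. Qed.

Lemma L0_csign f : L0 alpha f -> L0 alpha (fun t => csign (f t)).
Proof.
move=> mf; have mm := measurable_modulus mf.
have minv : measurable_fun D (fun t => (modulus f t) `^ (-1)).
  exact: (measurableT_comp (measurable_powR (-1)) mm).
have mz : measurable_fun D (\1_[set t | D t /\ 0 < modulus f t] : lebR R -> R).
  by apply: measurable_indic; exact: measurable_superlevel.
have H t : D t -> csign (f t) = f t * ((modulus f t) `^ (-1))%:C +
    (1 - (\1_[set t | D t /\ 0 < modulus f t] t))%:C.
  move=> Dt; rewrite powR_inv1 ?modulus_ge0// /csign.
  case: ifPn => [/eqP f0|f0].
    rewrite f0 mul0r add0r indicE memNset ?subr0//= => -[_].
    by rewrite -ltcR modulusE f0 normr0 ltxx.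
  rewrite indicE mem_set/=; last by split => //; rewrite -ltcR modulusE normr_gt0.
  by rewrite subrr addr0 fmorphV/= modulusE.
have mg : L0 alpha (fun t => f t * ((modulus f t) `^ (-1))%:C +
    (1 - (\1_[set t | D t /\ 0 < modulus f t] t))%:C).
  apply: L0_add; first by apply: L0_mul => //; exact: L0_real.
  by apply: L0_real; apply: measurable_funB => //; exact: measurable_cst.
case: mg => m1 m2; split.
  by apply: eq_measurable_fun m1 => t; rewrite inE => Dt; rewrite /= H.
by apply: eq_measurable_fun m2 => t; rewrite inE => Dt; rewrite /= H.
Qed.

Lemma L0_rearrangement_fun f : L0 alpha f -> L0 alpha (rearrangement_fun alpha f).
Proof.
move=> mf; apply: L0_real.
have mfine : measurable_fun [set: \bar R] (@fine R) by exact: fine_measurable.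
apply: (measurable_funS (measurable_lebR_itv `[0, +oo[) _
  (measurableT_comp mfine (measurable_rearr mf))).
by move=> t [t0 _] /=; rewrite in_itv/= t0.
Qed.

Lemma dist_rearrangement_fun f s : L0 alpha f -> finite_rearrangement alpha f ->
  (0 < alpha)%E -> 0 <= s ->
  Defs.distribution alpha (rearrangement_fun alpha f) s = Defs.distribution alpha f s.
Proof.
move=> mf ff a0 s0; rewrite -(leb_superlevel_mu_real mf ff s0); apply: ae_eq_measure.
- by apply: measurable_superlevel; exact: L0_rearrangement_fun.
- rewrite superlevel_mu_real//; apply: measurableD; first exact: measurable_ray.
  by apply: measurable_lebR; exact: measurable_set1.
exists [set 0]; split; first by apply: measurable_lebR; exact: measurable_set1.
  exact: leb_set1.
have mE t : modulus (rearrangement_fun alpha f) t = mu_real alpha f t.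
  by rewrite /modulus normc_real ger0_norm// mu_real_ge0.
move=> t /= H; apply: contrapT => t0; apply: H; rewrite mE in_itv/= andbT.
split=> [[[t1 _] st]|[t1 st]]; first by split => //; rewrite lt_neqAle t1 eq_sym andbT; exact/eqP.
split => //; split; first exact: ltW.
by move: st; rewrite mu_real_gt// => /lt_le_trans; apply; exact: dist_le_alpha.
Qed.

Lemma rearr_rearrangement_fun f t : L0 alpha f -> finite_rearrangement alpha f ->
  (0 < alpha)%E ->
  rearrangement alpha (rearrangement_fun alpha f) t = rearrangement alpha f t.
Proof.
move=> mf ff a0; congr ereal_inf; congr image; apply/seteqP; split => s /= [s0];
  by rewrite dist_rearrangement_fun// ltW.
Qed.

End L0Closure.

(** * Function spaces *)

Section Space.
Context {R : realType}.
Variable alpha : \bar R.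
Hypothesis alpha_gt0 : (0 < alpha)%E.
Variable E : banachFunctionSpace alpha.
Local Notation D := (dom alpha).
Local Notation rearr := (rearrangement alpha).
Local Notation mr := (mu_real alpha).
Local Notation K := (partial_mass alpha).
Local Notation finr := (finite_rearrangement alpha).
Implicit Types (x y : E) (f g : lebR R -> R[i]).

Lemma represents_fn x : represents x (fn x).
Proof. exact: aeW. Qed.

Lemma represents_eq x f g : represents x f -> eqL0 alpha f g -> represents x g.
Proof. by apply: filterS2 => t h h' Dt; rewrite h// h'. Qed.

Lemma represents_inj x y f : represents x f -> represents y f -> x = y.
Proof.
move=> xf yf; apply: fn_inj; apply: filterS2 xf yf => t h h' Dt.
by rewrite h// h'.
Qed.

Lemma represents_lin a x y f g : represents x f -> represents y g ->
  represents (a *: x + y) (fun t => a * f t + g t).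
Proof.
move=> xf yg; have H := fn_linear a x y.
apply: filterS3 H xf yg => t h h1 h2 Dt; rewrite h// h1// h2//.
Qed.

Lemma represents0 : represents (0 : E) (fun=> 0).
Proof.
have H := fn_linear (-1) (0 : E) (0 : E); rewrite scaler0 addr0 in H.
by apply: filterS H => t h Dt; rewrite h// mulN1r addNr.
Qed.

Lemma represents_sum n (c : 'I_n -> R[i]) (x : 'I_n -> E) (F : 'I_n -> lebR R -> R[i]) :
  (forall i, represents (x i) (F i)) ->
  represents (\sum_(i < n) c i *: x i) (fun t => \sum_(i < n) c i * F i t).
Proof.
elim: n c x F => [|n IH] c x F H.
  rewrite big_ord0; apply: represents_eq represents0 _.
  by apply: aeW => t _; rewrite big_ord0.
rewrite big_ord_recl; apply: represents_eq.
  apply: represents_lin (H ord0) _.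
  exact: (IH (fun i => c (lift ord0 i)) (fun i => x (lift ord0 i))
              (fun i => F (lift ord0 i)) (fun i => H (lift ord0 i))).
by apply: aeW => t _; rewrite big_ord_recl.
Qed.

Lemma represents_rearr x f t : L0 alpha f -> represents x f -> rearr (fn x) t = rearr f t.
Proof. by move=> mf xf; exact: eqL0_rearr (fn_L0 x) mf xf. Qed.

Lemma rearr_fn0 t : 0 <= t -> rearr (fn (0 : E)) t = 0%E.
Proof.
move=> t0; rewrite (represents_rearr t (L0_cst alpha 0) represents0).
apply/eqP; rewrite eq_le rearr_ge0 andbT (rearr_le _ (L0_cst alpha 0))//.
rewrite /Defs.distribution (_ : mkset _ = set0) ?measure0 ?lee_fin//.
apply/seteqP; split => s //= -[_].
by rewrite -ltcR modulusE normr0 ltxx.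
Qed.

Hypothesis E_sym : strongly_symmetric E.

(** If the primitive of the rearrangement of [x] were infinite at one time, it would
    be so at all times and [x] would submajorize [2 *: x]; the norm being monotone,
    [x] would vanish. *)
Lemma integral_rearr_lty x t : 0 < t ->
  (\int[leb]_(s in [set` `[0%R, t]]) rearr (fn x) s < +oo)%E.
Proof.
pose I y t := (\int[leb]_(s in [set` `[0%R, t]]) rearr (fn y) s)%E.
have mr_itv (a b : R) y (br bl : bool) : 0 <= a ->
    measurable_fun ([set` Interval (BSide br a) (BSide bl b)] : set (lebR R))
      (rearr (fn y) : lebR R -> \bar R).
  move=> a0; apply: (measurable_funS (measurable_lebR_itv `[0, +oo[) _
    (measurable_rearr (fn_L0 y))).
  move=> s /=; rewrite !in_itv/= andbT => /andP[+ _].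
  by case: br => [/(le_trans a0)//|/ltW/(le_trans a0)].
move=> t0; rewrite ltey; apply/eqP => It.
have Iy t' : 0 < t' -> I x t' = +oo%E.
  move=> t'0; have [tt'|t't] := leP t t'.
    apply/eqP; rewrite -leye_eq -It; apply: ge0_subset_integral.
    - exact: measurable_lebR_itv.
    - exact: measurable_lebR_itv.
    - exact: mr_itv.
    - by move=> s _; exact: rearr_ge0.
    - by move=> s /=; rewrite !in_itv/= => /andP[-> /le_trans ->].
  have [rt'|rt'] := eqVneq (rearr (fn x) t') +oo%E.
    apply/eqP; rewrite -leye_eq.
    have -> : +oo%E = (\int[leb]_(s in [set` `[0%R, t']]) (cst +oo%E s))%E.
      rewrite integral_cst/=; last exact: measurable_lebR_itv.
      by rewrite leb_itv/= lte_fin t'0 gt0_mulye// sube0 lte_fin.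
    apply: ge0_le_integral.
    - exact: measurable_lebR_itv.
    - by move=> s _; rewrite leey.
    - exact: measurable_cst.
    - exact: mr_itv.
    - move=> s /=; rewrite in_itv/= => /andP[_ st]; rewrite -rt'.
      exact: rearr_noninc (fn_L0 x) st.
  have rtE : (fine (rearr (fn x) t'))%:E = rearr (fn x) t'.
    by rewrite fineK// ge0_fin_numE ?rearr_ge0// ltey.
  apply/eqP; rewrite -leye_eq leNgt; apply/negP => It'.
  have : (I x t <= I x t' + (fine (rearr (fn x) t') * (t - t'))%:E)%E.
    rewrite /I (_ : [set` `[0, t]] = [set` `[0, t']] `|` [set` `]t', t]]); last first.
      apply/seteqP; split => s /=; rewrite !in_itv/=.
        by move=> /andP[-> ->]; case: (leP s t'); [left|right].
      by move=> [/andP[-> /le_trans ->//]|/andP[/(lt_trans t'0)/ltW -> ->]]//; exact: ltW.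
    rewrite ge0_integral_setU; last first.
    - apply/disj_set2P/seteqP; split => s //=; rewrite !in_itv/=.
      by move=> [/andP[_ st] /andP[]]; rewrite ltNge st.
    - by move=> s _; exact: rearr_ge0.
    - apply/measurable_funU; try exact: measurable_lebR_itv.
      by split; apply: mr_itv => //; exact: ltW.
    - exact: measurable_lebR_itv.
    - exact: measurable_lebR_itv.
    apply: leeD2l.
    have -> : (fine (rearr (fn x) t') * (t - t'))%:E =
        (\int[leb]_(s in [set` `]t', t]]) (cst (rearr (fn x) t') s))%E.
      rewrite integral_cst/=; last exact: measurable_lebR_itv.
      by rewrite leb_itv/= lte_fin t't -EFinB -rtE.
    apply: ge0_le_integral.
    - exact: measurable_lebR_itv.
    - by move=> s _; exact: rearr_ge0.
    - by apply: mr_itv; exact: ltW.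
    - exact: measurable_cst.
    - move=> s /=; rewrite in_itv/= => /andP[/ltW st _].
      exact: rearr_noninc (fn_L0 x) st.
  rewrite {1}/I It leye_eq => /eqP; apply/eqP; rewrite -ltey.
  by rewrite lte_add_pinfty// ltry.
have x2 : `|2 *: x| <= `|x|.
  by apply: E_sym.2 => t' t'0; rewrite -/(I x t') Iy// leey.
have x0 : x = 0.
  apply/eqP; rewrite -normr_le0; move: x2; rewrite normrZ ger0_norm//.
  by rewrite mulr_natl mulr2n gerDl.
move: It; rewrite integral0_eq// => s; rewrite /= in_itv/= => /andP[s0 _].
by rewrite x0 rearr_fn0.
Qed.

Lemma finite_rearr_fn x : finr (fn x).
Proof.
move=> t t0; rewrite ltey; apply/eqP => rt.
have := integral_rearr_lty x t0; rewrite ltNge => /negP; apply.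
have -> : +oo%E = (\int[leb]_(s in [set` `[0%R, t]]) (cst +oo%E s))%E.
  rewrite integral_cst/=; last exact: measurable_lebR_itv.
  by rewrite leb_itv/= lte_fin t0 gt0_mulye// sube0 lte_fin.
apply: ge0_le_integral.
- exact: measurable_lebR_itv.
- by move=> s _; rewrite leey.
- exact: measurable_cst.
- apply: (measurable_funS (measurable_lebR_itv `[0, +oo[) _
    (measurable_rearr (fn_L0 x))).
  by move=> s /=; rewrite !in_itv/= andbT => /andP[+ _].
- move=> s /=; rewrite in_itv/= => /andP[_ st]; rewrite -rt.
  exact: rearr_noninc (fn_L0 x) st.
Qed.

Lemma partial_mass_lty x t : 0 < t -> (K (fn x) t < +oo)%E.
Proof.
move=> t0; rewrite -(integral_rearr (fn_L0 x) (@finite_rearr_fn x) t0).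
exact: integral_rearr_lty.
Qed.

Lemma norm_le_partial_mass x y :
  (forall t, 0 < t -> (K (fn x) t <= K (fn y) t)%E) -> `|x| <= `|y|.
Proof.
move=> H; apply: E_sym.2 => t t0.
rewrite (integral_rearr (fn_L0 x) (@finite_rearr_fn x) t0).
rewrite (integral_rearr (fn_L0 y) (@finite_rearr_fn y) t0); exact: H.
Qed.

Lemma norm_le_rearr x y :
  (forall t, 0 <= t -> (rearr (fn x) t <= rearr (fn y) t)%E) -> `|x| <= `|y|.
Proof.
move=> H; have [x' xx' le] := E_sym.1 (fn x) y (fn_L0 x) H.
by rewrite (represents_inj (represents_fn x) xx').
Qed.

End Space.

(** * Perturbations of k-extreme points *)

Section UnitMean.
Context {R : realType} (X : normedModType R[i]).

Lemma unit_of_mean k (x : X) (u : 'I_k.+1 -> X) : `|x| = 1 ->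
  x = (k.+1%:R)^-1 *: \sum_(i < k.+1) u i -> (forall i, `|u i| <= 1) ->
  forall i, `|u i| = 1.
Proof.
move=> x1 xE u1 i; apply/eqP; rewrite eq_le u1/=.
have k0 : (k.+1%:R : R[i]) != 0 by rewrite pnatr_eq0.
have ke : k.+1%:R = \sum_(j < k.+1) (1 : R[i]) by rewrite sumr_const card_ord.
have x1' : k.+1%:R <= \sum_(j < k.+1) `|u j|.
  have e : \sum_(j < k.+1) u j = k.+1%:R *: x.
    by rewrite xE scalerA mulfV// scale1r.
  have -> : (k.+1%:R : R[i]) = `|k.+1%:R *: x| by rewrite normrZ x1 mulr1 normr_nat.
  by rewrite -e; exact: ler_norm_sum.
rewrite ke (bigD1 i)//= [X in _ <= X](bigD1 i)//= in x1'.
rewrite -(lerD2r (\sum_(j < k.+1 | j != i) (1 : R[i]))); apply: (le_trans x1').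
by rewrite lerD2l; apply: ler_sum => j _.
Qed.

End UnitMean.

Section ScaledIndicator.
Context d (T : measurableType d) {R : realType}.
Variable mu : {measure set T -> \bar R}.

Lemma integral_scaled_indic (A S : set T) (c : R) : measurable A -> measurable S ->
  0 <= c -> (\int[mu]_(t in A) (c * \1_S t)%:E = c%:E * mu (S `&` A))%E.
Proof.
move=> mA mS c0; under eq_integral do rewrite EFinM.
rewrite ge0_integralZl_EFin//=; first by rewrite integral_indic.
by apply/measurable_EFinP; exact: measurable_indic.
Qed.

End ScaledIndicator.

Section Equipartition.
Context {R : realType}.
Implicit Types A W : set (lebR R).

(** Initial segments of [W] have arbitrarily small positive measure. *)
Lemma small_subset W (m : \bar R) : measurable W ->
  (forall t, W t -> 0 <= (t : R)) -> (0 < leb W)%E -> (0 < m)%E ->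
  exists A, [/\ measurable A, A `<=` W, (0 < leb A)%E & (leb A < m)%E].
Proof.
move=> mW W0 lW m0; have [r [r0 rm]] := ereal_gt0_between m0.
exists (W `&` [set t | (left_mass W t <= r%:E)%E]); split.
- exact: measurable_initial.
- exact: subIsetl.
- by rewrite leb_initial ?ltW// lt_min lW lte_fin.
- by rewrite leb_initial ?ltW// gt_min rm orbT.
Qed.

(** Cut [A] from left to right. That the pieces partition [A] is recorded by their
    indicators, the form in which it is summed later. *)
Lemma equipartition A (a : R) n : measurable A -> (forall t, A t -> 0 <= (t : R)) ->
  leb A = a%:E -> 
  exists B : 'I_n.+1 -> set (lebR R),
    [/\ forall i, measurable (B i), forall i, leb (B i) = (a / n.+1%:R)%:E &
        forall t, \sum_(i < n.+1) (\1_(B i) t : R) = \1_A t].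
Proof.
move=> mA A0 lA; have a0 : 0 <= a by rewrite -lee_fin -lA measure_ge0.
pose r i : R := a * i%:R / n.+1%:R.
have r0 i : 0 <= r i by rewrite divr_ge0 ?mulr_ge0.
have ra i : (i <= n.+1)%N -> r i <= a.
  move=> ni; rewrite /r ler_pdivrMr ?ltr0n//; apply: ler_wpM2l => //.
  by rewrite ler_nat.
pose J i := if i is 0%N then set0 else A `&` [set t | (left_mass A t <= (r i)%:E)%E].
have mJ i : measurable (J i) by case: i => [|i]; [exact: measurable0|exact: measurable_initial].
have lJ i : (i <= n.+1)%N -> leb (J i) = (r i)%:E.
  case: i => [|i] ni; first by rewrite /r/= mulr0 mul0r measure0.
  by rewrite leb_initial// lA -EFin_min min_r ?ra.
have JS i : J i `<=` J i.+1.
  case: i => [|i]; first exact: sub0set.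
  move=> t [At ti]; split => //; apply: le_trans ti _; rewrite lee_fin /r.
  by rewrite ler_pM2r ?invr_gt0// ler_wpM2l// ler_nat.
have JA : J n.+1 = A.
  apply/seteqP; split => t; first by case.
  move=> At; split => //=; rewrite /r mulfK// -lA; apply: le_measure; last exact: subIsetl.
    by rewrite inE; apply: measurableI => //; exact: measurable_left.
  by rewrite inE.
exists (fun i : 'I_n.+1 => J i.+1 `\` J i); split.
- by move=> i; exact: measurableD.
- move=> i; have i1 : (i < n.+1)%N := ltn_ord i; have i2 := ltnW i1.
  rewrite measureD//; last first.
    by rewrite -[X in (X < _)%E]/(leb (J i.+1)) (lJ _ i1) ltry.
  rewrite setIidr; last exact: (JS i).
  transitivity (leb (J i.+1) - leb (J i))%E => //.
  rewrite (lJ _ i1) (lJ _ i2).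
  by rewrite -EFinB /r -mulrBl -mulrBr -natrB// subSnn mulr1.
move=> t.
transitivity (\sum_(i < n.+1) ((\1_(J i.+1) t : R) - \1_(J i) t)).
  apply: eq_bigr => i _; rewrite !indicE !in_setD.
  have [tJ|tJ] := boolP (t \in J i); last by rewrite andbT subr0.
  by rewrite andbF mem_set ?subrr//; apply: JS; rewrite inE in tJ.
rewrite -(big_mkord xpredT (fun i => (\1_(J i.+1) t : R) - \1_(J i) t)) telescope_sumr//.
by rewrite JA !indicE (in_set0 t) subr0.
Qed.

End Equipartition.

Section Perturbation.
Context {R : realType}.
Variable alpha : \bar R.
Hypothesis alpha_gt0 : (0 < alpha)%E.
Variable E : banachFunctionSpace alpha.
Hypothesis E_sym : strongly_symmetric E.
Local Notation D := (dom alpha).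
Local Notation rearr := (rearrangement alpha).
Local Notation dist := (Defs.distribution alpha).
Implicit Types (x y : E) (f g : lebR R -> R[i]).
Local Notation nc := (@ComplexField.Normc.normc R).

Let mD : measurable D. Proof. exact: measurable_dom. Qed.

(** Such a [z] has a smaller rearrangement than [x], whose modulus exceeds [d] on a
    larger set. *)
Lemma represents_small x A (d : R) (z : lebR R -> R[i]) : 0 < d ->
  L0 alpha z -> measurable A -> (leb A <= dist (fn x) d)%E ->
  (forall t, D t -> nc (z t) <= d) -> (forall t, ~ A t -> z t = 0) ->
  exists y : E, represents y z.
Proof.
move=> d0 mz mA Ad zd zA.
have [|y yz _] := E_sym.1 z x mz; last by exists y.
move=> t _; apply: le_ereal_inf_tmp => _ [s [s0 st] <-].
apply: ereal_inf_lbound; exists s => //; split => //; apply: le_trans st.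
have [ds|sd] := leP d s.
  rewrite /Defs.distribution (_ : mkset _ = set0) ?measure0 ?dist_ge0//.
  by apply/seteqP; split => r //= -[/zd zr]; rewrite ltNge (le_trans zr).
apply: (@le_trans _ _ (leb A)).
  apply: le_measure; rewrite ?inE//; first exact: measurable_superlevel.
  move=> r /= [_ sr]; apply: contrapT => /zA zr0; move: sr.
  by rewrite /modulus zr0 ltNge -lecR -norm_normc normr0 lecR ltW.
apply: (le_trans Ad); apply: dist_le; first exact: fn_L0.
exact: ltW.
Qed.

(** Cut [A] in [k + 1] pieces of equal measure. The perturbations proportional to
    the indicator of a piece minus [1 / (k + 1)] add up to zero, so that [x] is the
    mean of the perturbed vectors. These are independent: [A] is too small to
    contain the support of [x], so the coefficients of a relation add up to zero,
    and on each piece the relation then isolates one coefficient. *)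
Lemma perturbation_not_k_extreme k x A (d eta : R) : 0 < eta -> eta <= d ->
  measurable A -> A `<=` D -> (0 < leb A)%E -> (leb A < dist (fn x) d)%E ->
  (forall (y : lebR R -> R) (x' : E), measurable_fun D y ->
     (forall t, `|y t| <= eta) -> (forall t, ~ A t -> y t = 0) ->
     (\int[leb]_(t in A) (y t + eta)%:E = eta%:E * leb A)%E ->
     represents x' (fun t => fn x t + csign (fn x t) * (y t)%:C) -> `|x'| <= 1) ->
  ~ k_extreme k x.
Proof.
move=> eta0 etad mA AD A0 Ad H [_ x1 Hx].
have d0 : 0 < d by exact: lt_le_trans etad.
have mf : L0 alpha (fn x) := fn_L0 x.
have Afin : leb A \is a fin_num.
  by rewrite ge0_fin_numE// (lt_le_trans Ad)// leey.
pose a := fine (leb A); have lA : leb A = a%:E by rewrite fineK.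
have a0 : 0 < a by rewrite -lte_fin -lA.
have Age0 t : A t -> 0 <= (t : R) by move=> /AD[].
have [B [mB lB sB]] := equipartition k mA Age0 lA.
have BA i t : B i t -> A t.
  move=> Bt; apply: contrapT => nA; have := sB t; rewrite indicE memNset// => /eqP.
  rewrite psumr_eq0; last by move=> j _; rewrite indicE.
  by move=> /allP/(_ i (mem_index_enum _)); rewrite indicE mem_set//= oner_eq0.
have Bdisj i j t : B j t -> i != j -> (\1_(B i) t : R) = 0.
  move=> Bt ij; have := sB t; rewrite indicE mem_set/=; last exact: BA Bt.
  rewrite (bigD1 j)//= indicE mem_set//= => /eqP.
  rewrite -subr_eq0 addrAC subrr add0r psumr_eq0; last by move=> l _; rewrite indicE.
  by move=> /allP/(_ i (mem_index_enum _)); rewrite ij/= => /eqP.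
have mBi i : measurable_fun D (\1_(B i) : lebR R -> R) by exact: measurable_indic.
have exb i : exists y : E,
    represents y (fun t => csign (fn x t) * (eta * \1_(B i) t)%:C).
  refine (@represents_small x A d (fun t => csign (fn x t) * (eta * \1_(B i) t)%:C) d0 _ mA (ltW Ad) _ _).
  - apply: L0_mul; first exact: L0_csign.
    by apply: L0_real; apply: measurable_funM => //; exact: measurable_cst.
  - move=> t _; rewrite normc_mul normc_csign mul1r normc_real ger0_norm.
      rewrite indicE; apply: le_trans etad; apply: ler_piMr; first exact: ltW.
      by rewrite lern1 leq_b1.
    by rewrite mulr_ge0// ltW.
  - by move=> t nA; rewrite indicE memNset ?mulr0 ?mulr0// => /BA.
have [b bE] := choice exb.
pose n1 : R := k.+1%:R^-1.
pose u i : E := x + (b i - (n1%:C) *: \sum_(j < k.+1) b j).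
pose y i (t : lebR R) : R := eta * (\1_(B i) t - n1 * \1_A t).
have uE i : represents (u i) (fun t => fn x t + csign (fn x t) * (y i t)%:C).
  have sE : represents (\sum_(j < k.+1) b j)
      (fun t => csign (fn x t) * (eta * \1_A t)%:C).
    apply: represents_eq.
      have := represents_sum (fun=> 1) bE.
      under eq_bigr do rewrite scale1r.
      by apply.
    apply: aeW => t _; under eq_bigr do rewrite mul1r.
    by rewrite -mulr_sumr -rmorph_sum/= -mulr_sumr sB.
  have := represents_lin 1 (represents_fn x)
    (represents_lin (- n1%:C) sE (bE i)).
  rewrite scale1r scaleNr [- _ + _]addrC -/(u i) => /represents_eq; apply.
  apply: aeW => t _; rewrite mul1r; congr (_ + _).
  by rewrite /y mulrBr rmorphB/= mulrBr addrC mulNr; congr (_ - _);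
    rewrite !rmorphM/=; ring.
have n10 : 0 < n1 by rewrite invr_gt0.
have n11 : n1 <= 1 by rewrite invf_le1// ler1n.
have y_le i t : `|y i t| <= eta.
  rewrite /y normrM gtr0_norm//; apply: ler_piMr; first exact: ltW.
  rewrite ler_norml.
  have : (\1_(B i) t : R) <= \1_A t.
    rewrite !indicE ler_nat; case: (boolP (t \in B i)) => // /set_mem/BA tA.
    by rewrite mem_set.
  rewrite !indicE; case: (t \in A); case: (t \in B i) => //=;
    rewrite ?mulr0 ?mulr1 => _; clear - n10 n11; apply/andP; split; lra.
have u1 i : `|u i| <= 1.
  apply: (H (y i)) (uE i) => //.
  - apply: measurable_funM; first exact: measurable_cst.
    apply: (@measurable_funB _ _ _ _ (\1_(B i) : lebR R -> R)).
      exact: measurable_indic.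
    by apply: measurable_funM; [exact: measurable_cst|exact: measurable_indic].
  - move=> t nA; rewrite /y !indicE (memNset nA) (@memNset _ (B i)).
      by rewrite mulr0 subr0 mulr0.
    by move/BA.
  - have e1 : 0 <= eta * (1 - n1) by rewrite mulr_ge0 ?subr_ge0// ltW.
    transitivity (\int[leb]_(t in A)
      ((eta * (1 - n1))%:E + (eta * \1_(B i) t)%:E))%E.
      apply: eq_integral => t tA; rewrite -EFinD; congr EFin.
      by rewrite /y [\1_A t]indicE tA/= mulr1; ring.
    rewrite ge0_integralD; first last.
    + by apply/measurable_EFinP; apply: measurable_funM; [exact: measurable_cst|exact: measurable_indic].
    + by move=> t _; rewrite lee_fin mulr_ge0 ?ler0n// ltW.
    + exact: measurable_cst.
    + by move=> t _; rewrite lee_fin.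
    + exact: mA.
    rewrite integral_cst//=.
    have -> : (\int[leb]_(t in A) (eta * \1_(B i) t)%:E = eta%:E * leb (B i))%E.
      rewrite integral_scaled_indic ?setIidl//; first exact: BA.
      exact: ltW.
    rewrite lB lA -!EFinM -EFinD; congr EFin; rewrite -/n1; ring.
have k0 : (k.+1%:R : R[i]) != 0 by rewrite pnatr_eq0.
have n1E : n1%:C = k.+1%:R^-1 :> R[i] by rewrite fmorphV/= rmorph_nat.
have zs : \sum_(i < k.+1) (b i - n1%:C *: \sum_(j < k.+1) b j) = 0.
  by rewrite sumrB sumr_const card_ord -scaler_nat scalerA n1E divff// scale1r subrr.
have xE : x = (k.+1%:R)^-1 *: \sum_(i < k.+1) u i.
  rewrite /u big_split/= zs addr0 sumr_const card_ord.
  by rewrite -[x *+ _]scaler_nat scalerA mulVf// scale1r.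
have u_1 := unit_of_mean x1 xE u1.
have [c [i0 ci0] cu] := Hx u u_1 xE.
(* Outside of [A], where [x] does not vanish, the relation reads [sum c = 0]. *)
have rel : {ae leb, forall t, D t ->
    \sum_(i < k.+1) c i * (fn x t + csign (fn x t) * (y i t)%:C) = 0}.
  have := represents_sum c uE; rewrite cu => h1.
  apply: filterS2 h1 (represents0 E) => t h1 h0 Dt.
  by rewrite -h1// h0.
have sc0 : \sum_(i < k.+1) c i = 0.
  apply: contrapT => /eqP sc0.
  move: Ad; rewrite ltNge => /negP; apply; apply: ae_le_measure => //.
    exact: measurable_superlevel.
  apply: filterS rel => t h [Dt dt]; apply: contrapT => nA.
  have := h Dt; under eq_bigr => i _.
    rewrite /y !indicE (memNset nA) (@memNset _ (B i)); last by move/BA.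
    rewrite mulr0 subr0 mulr0 rmorph0 mulr0 addr0; over.
  rewrite -mulr_suml => /eqP; rewrite mulf_eq0 (negPf sc0)/= => /eqP f0.
  by move: dt; rewrite /modulus f0 ltNge -lecR -norm_normc normr0 lecR ltW.
(* On the piece [B i0], it now reads [c i0 = 0]. *)
have : (leb (B i0) <= leb (set0 : set (lebR R)))%E.
  apply: ae_le_measure => //; apply: filterS rel => t h Bt.
  have At := BA _ _ Bt; have := h (AD _ At).
  under eq_bigr do rewrite mulrDr.
  rewrite big_split/= -mulr_suml sc0 mul0r add0r.
  under eq_bigr => i _.
    rewrite /y mulrBr rmorphB/= mulrBr mulrBr; over.
  rewrite sumrB -[X in _ - X]mulr_suml sc0 mul0r subr0 (bigD1 i0)//= big1 ?addr0.
    rewrite indicE mem_set//= mulr1 => /eqP; rewrite mulf_eq0 (negPf ci0)/=.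
    rewrite mulf_eq0 -normr_eq0 norm_csign oner_eq0/= -[0 in X in X -> _](rmorph0 (real_complex R)).
    by move=> /eqP/complexI/eqP; rewrite gt_eqF.
  by move=> i ii0; rewrite (Bdisj _ _ _ Bt ii0) mulr0 rmorph0 !mulr0.
by rewrite measure0 lB lee_fin leNgt divr_gt0.
Qed.

End Perturbation.

Section ExcessEstimates.
Context {R : realType}.
Variable alpha : \bar R.
Local Notation D := (dom alpha).
Local Notation dist := (Defs.distribution alpha).
Local Notation Phi := (excess alpha).
Implicit Types f g : lebR R -> R[i].

Let mD : measurable D. Proof. exact: measurable_dom. Qed.

Lemma measurable_pospart_modulus f v (A : set (lebR R)) : L0 alpha f ->
  measurable A -> A `<=` D ->
  measurable_fun A (fun t => (Num.max (modulus f t - v) 0)%:E).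
Proof.
move=> mf mA AD; apply: measurable_pospart => //.
by apply: (measurable_funS mD AD); exact: measurable_modulus.
Qed.

Lemma eqL0_excess f g v : L0 alpha f -> L0 alpha g -> eqL0 alpha f g ->
  Phi f v = Phi g v.
Proof.
move=> mf mg fg; apply: ge0_ae_eq_integral; first exact: mD.
- exact: measurable_pospart_modulus.
- exact: measurable_pospart_modulus.
- by move=> t _; exact: pospart_ge0.
- by move=> t _; exact: pospart_ge0.
- by apply: filterS fg => t fg Dt; rewrite /modulus fg.
Qed.

Lemma excess_antitone f v w : L0 alpha f -> v <= w -> (Phi f w <= Phi f v)%E.
Proof.
move=> mf vw; apply: ge0_le_integral; first exact: mD.
- by move=> t _; exact: pospart_ge0.
- exact: measurable_pospart_modulus.
- exact: measurable_pospart_modulus.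
- by move=> t _; rewrite lee_fin ge_max !le_max lexx orbT andbT lerD2l lerN2 vw.
Qed.

Lemma excess_step f v w : L0 alpha f -> w <= v ->
  (Phi f w <= Phi f v + (v - w)%:E * dist f w)%E.
Proof.
move=> mf wv; have vw : 0 <= v - w by rewrite subr_ge0.
pose S := [set t | D t /\ w < modulus f t].
have mS : measurable S by exact: measurable_superlevel.
have SE : ((v - w)%:E * dist f w = \int[leb]_(t in D) ((v - w) * \1_S t)%:E)%E.
  by rewrite integral_scaled_indic// setIidl// => t [].
have mind : measurable_fun D (fun t => ((v - w) * \1_S t)%:E).
  apply/measurable_EFinP; apply: measurable_funM; first exact: measurable_cst.
  exact: measurable_indic.
rewrite SE -ge0_integralD; last 5 first.
- exact: mD.
- by move=> t _; exact: pospart_ge0.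
- exact: measurable_pospart_modulus.
- by move=> t _; rewrite lee_fin mulr_ge0.
- exact: mind.
apply: ge0_le_integral; first exact: mD.
- by move=> t _; exact: pospart_ge0.
- exact: measurable_pospart_modulus.
- apply: emeasurable_funD; last exact: mind.
  exact: measurable_pospart_modulus.
move=> t Dt; rewrite -EFinD lee_fin indicE.
have [wt|tw] := ltP w (modulus f t).
  rewrite mem_set//= mulr1 [X in X <= _]max_l; last by lra.
  have : modulus f t - v <= Num.max (modulus f t - v) 0 by rewrite le_max lexx.
  by move=> h; lra.
rewrite max_r ?subr_le0//; apply: addr_ge0; last by rewrite mulr_ge0.
by rewrite le_max lexx orbT.
Qed.

Lemma excess_lower f w w' : L0 alpha f -> w <= w' ->
  ((w' - w)%:E * dist f w' <= Phi f w)%E.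
Proof.
move=> mf ww'; pose S := [set t | D t /\ w' < modulus f t].
have mS : measurable S by exact: measurable_superlevel.
have SD : S `<=` D by move=> t [].
apply: (@le_trans _ _ (\int[leb]_(t in S) (Num.max (modulus f t - w) 0)%:E)%E).
  rewrite -integral_cst//; apply: ge0_le_integral; first exact: mS.
  - by move=> t _; rewrite lee_fin subr_ge0.
  - exact: measurable_cst.
  - exact: measurable_pospart_modulus.
  - by move=> t [_ wt]; rewrite lee_fin le_max lerD2r ltW.
rewrite /excess; apply: ge0_subset_integral; [exact: mS|exact: mD| | |exact: SD].
  exact: measurable_pospart_modulus.
by move=> t _; exact: pospart_ge0.
Qed.

End ExcessEstimates.

Section Necessary.
Context {R : realType}.
Variable alpha : \bar R.
Hypothesis alpha_gt0 : (0 < alpha)%E.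
Variable E : banachFunctionSpace alpha.
Hypothesis E_sym : strongly_symmetric E.
Local Notation D := (dom alpha).
Local Notation rearr := (rearrangement alpha).
Local Notation dist := (Defs.distribution alpha).
Local Notation mr := (mu_real alpha).
Local Notation K := (partial_mass alpha).
Local Notation Phi := (excess alpha).
Local Notation finr := (finite_rearrangement alpha).
Implicit Types (x y : E) (f g : lebR R -> R[i]).

Let mD : measurable D. Proof. exact: measurable_dom. Qed.

Lemma exists_level x : `|x| = 1 -> exists2 d : R, 0 < d & (0 < dist (fn x) d)%E.
Proof.
move=> x1; apply: contrapT => H.
have d0 d : 0 < d -> (dist (fn x) d <= 0)%E.
  by move=> d0; rewrite leNgt; apply/negP => hd; apply: H; exists d.
have : `|x| <= `|0 : E|.
  apply: (norm_le_rearr E_sym) => t t0.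
  rewrite rearr_fn0// (rearr_le _ (fn_L0 x) (lexx 0)).
  apply: (@le_trans _ _ 0%E); last by rewrite lee_fin.
  by apply: dist_right_cont; [exact: fn_L0|exact: d0].
by rewrite x1 normr0 ler10.
Qed.

Section PerturbedModulus.
Variables (f : lebR R -> R[i]) (y : lebR R -> R) (A : set (lebR R)) (eta : R).
Hypotheses (yA : forall t, ~ A t -> y t = 0) (y_eta : forall t, `|y t| <= eta).

Definition perturbed (t : lebR R) : R[i] := f t + csign (f t) * (y t)%:C.

Lemma modulus_perturbed t : modulus perturbed t = `|modulus f t + y t|.
Proof.
rewrite /modulus /perturbed {1}[f t]csignE -mulrDr -rmorphD/= normc_mul normc_csign mul1r.
by rewrite normc_real.
Qed.

Lemma modulus_perturbed_out t : ~ A t -> modulus perturbed t = modulus f t.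
Proof. by move=> nA; rewrite modulus_perturbed yA// addr0 ger0_norm ?modulus_ge0. Qed.

Lemma modulus_perturbed_le t : modulus perturbed t <= modulus f t + eta.
Proof.
rewrite modulus_perturbed (le_trans (ler_normD _ _))// ger0_norm ?modulus_ge0//.
by rewrite lerD2l.
Qed.

Lemma modulus_perturbed_eq t : eta <= modulus f t -> modulus perturbed t = modulus f t + y t.
Proof.
move=> h; rewrite modulus_perturbed ger0_norm//; have := y_eta t.
rewrite ler_norml => /andP[h1 _]; lra.
Qed.

Lemma L0_perturbed : L0 alpha f -> measurable_fun D y -> L0 alpha perturbed.
Proof.
by move=> mf my; exact: (L0_add mf (L0_mul (L0_csign mf) (L0_real my))).
Qed.

End PerturbedModulus.

(** Where [|x|] stays below the limit of its rearrangement, [x] can be perturbed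
    without increasing the measures of the superlevel sets above the limit; those
    below it are infinite already. *)
Lemma k_extreme_above_limit k x : k_extreme k x -> above_limit alpha (fn x).
Proof.
move=> kx s s0 ds; have [_ x1 _] := kx.
have mf := fn_L0 x; have mg := measurable_modulus mf.
have mW n : measurable [set t | D t /\ modulus (fn x) t <= s - n.+1%:R^-1].
  have := mg mD [set` `]-oo, s - n.+1%:R^-1]] (measurable_itv _).
  by congr measurable; apply/seteqP; split => t /=; rewrite in_itv/= => -[].
have [H|] := pselect (forall n : nat,
    leb [set t | D t /\ modulus (fn x) t <= s - n.+1%:R^-1] = 0%E).
  have : {ae leb, forall t (n : nat), D t -> s - n.+1%:R^-1 < modulus (fn x) t}.
    apply: ae_foralln => n.
    exists [set t | D t /\ modulus (fn x) t <= s - n.+1%:R^-1].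
    split; [exact: mW|exact: H|].
    by move=> t /= /not_implyP[Dt /negP]; rewrite -leNgt.
  apply: filterS => t h Dt; rewrite leNgt; apply/negP => ts.
  have ts' : 0 < s - modulus (fn x) t by rewrite subr_gt0.
  have [n _ /(_ n (leqnn n))/= nt] := near_infty_natSinv_lt (PosNum ts').
  by have := h n Dt; rewrite ltNge ltW// ltrBrDl -ltrBrDr.
move=> /existsNP[n W0]; exfalso.
have {}W0 : (0 < leb [set t | D t /\ (modulus (fn x) t <= s - n.+1%:R^-1)%R])%E.
  by rewrite lt0e measure_ge0 andbT; apply/eqP.
have [d d0 hd] := exists_level x1.
have [|A [mA AW A0 Ad]] := small_subset (mW n) _ W0 hd; first by move=> t [[]].
have AD : A `<=` D by move=> t /AW[].
pose eta := Num.min d n.+1%:R^-1.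
have eta0 : 0 < eta by rewrite lt_min d0 invr_gt0 ltr0n.
have eta_n : eta <= n.+1%:R^-1 by rewrite ge_min lexx orbT.
suff nkx : ~ k_extreme k x by exact: nkx.
apply: (perturbation_not_k_extreme E_sym eta0 _ mA AD A0 Ad).
  by rewrite ge_min lexx.
move=> y x' my y_eta yA _ x'E; rewrite -x1; apply: (norm_le_rearr E_sym) => t t0.
have mp := L0_perturbed mf my.
rewrite (represents_rearr t mp x'E).
apply: le_ereal_inf_tmp => _ [r [r0 rt] <-].
apply: ereal_inf_lbound; exists r => //; split => //; apply: le_trans rt.
have [rs|sr] := leP r s.
  by apply: le_trans (dist_le mf rs); rewrite ds leey.
apply: le_measure; rewrite ?inE; try exact: measurable_superlevel.
move=> u /= [Du]; have [Au|nAu] := pselect (A u); last first.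
  by rewrite (modulus_perturbed_out (fn x) yA nAu).
have [_ us] := AW _ Au => ru.
have ru' := lt_le_trans ru (modulus_perturbed_le (fn x) y_eta u).
have us' : modulus (fn x) u + eta <= s by rewrite -[s](subrK n.+1%:R^-1) lerD.
by have := lt_trans (lt_le_trans ru' us') sr; rewrite ltxx.
Qed.

End Necessary.

Section LocalExcess.
Context {R : realType}.
Variable alpha : \bar R.
Local Notation D := (dom alpha).
Local Notation Phi := (excess alpha).
Implicit Types f g : lebR R -> R[i].

Let mD : measurable D. Proof. exact: measurable_dom. Qed.

Lemma excess_local F f w (c : \bar R) A : L0 alpha F -> L0 alpha f ->
  measurable A -> A `<=` D ->
  (forall t, ~ A t -> modulus F t = modulus f t) ->
  (\int[leb]_(t in A) (Num.max (modulus F t - w) 0)%:E <=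
   \int[leb]_(t in A) (Num.max (modulus f t - w) 0)%:E + c)%E ->
  (Phi F w <= Phi f w + c)%E.
Proof.
move=> mF mf mA AD out le.
have split G : L0 alpha G ->
    Phi G w = (\int[leb]_(t in D `\` A) (Num.max (modulus G t - w) 0)%:E +
               \int[leb]_(t in A) (Num.max (modulus G t - w) 0)%:E)%E.
  have DE : D = (D `\` A) `|` A by rewrite setUC (setDUK AD).
  move=> mG; rewrite /excess {1}DE ge0_integral_setU; first by [].
  - exact: measurableD.
  - exact: mA.
  - by rewrite -DE; exact: (measurable_pospart_modulus w mG mD (@subset_refl _ D)).
  - by move=> t _; exact: pospart_ge0.
  - by apply/disj_set2P/seteqP; split => t //= -[[_ nA] At].
rewrite (split F mF) (split f mf).
have eD : (\int[leb]_(t in D `\` A) (Num.max (modulus F t - w) 0)%:E =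
    \int[leb]_(t in D `\` A) (Num.max (modulus f t - w) 0)%:E)%E.
  by apply: eq_integral => t /set_mem[_ nA]; rewrite out.
by rewrite eD -[leRHS]addeA; apply: leeD2l.
Qed.

Variables (f : lebR R -> R[i]) (y : lebR R -> R) (A : set (lebR R)) (eta : R).
Hypotheses (mf : L0 alpha f) (my : measurable_fun D y).
Hypotheses (mA : measurable A) (AD : A `<=` D).
Hypotheses (yA : forall t, ~ A t -> y t = 0) (y_eta : forall t, `|y t| <= eta).
Local Notation F := (perturbed f y).

Let mF : L0 alpha F. Proof. exact: L0_perturbed. Qed.

Let eta0 : 0 <= eta. Proof. exact: le_trans (normr_ge0 _) (y_eta 0). Qed.

Lemma excess_perturbed_le w : (Phi F w <= Phi f w + eta%:E * leb A)%E.
Proof.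
apply: (excess_local mF mf mA AD); first by move=> t; exact: modulus_perturbed_out.
have mm := measurable_pospart_modulus w mf mA AD.
rewrite -integral_cst; last exact: mA.
rewrite -ge0_integralD; last 5 first.
- exact: mA.
- by move=> t _; exact: pospart_ge0.
- exact: mm.
- by move=> t _; rewrite lee_fin.
- exact: measurable_cst.
apply: ge0_le_integral; first exact: mA.
- by move=> t _; exact: pospart_ge0.
- exact: (measurable_pospart_modulus w mF mA AD).
- by apply: emeasurable_funD; [exact: mm|exact: measurable_cst].
move=> t _; rewrite -EFinD lee_fin ge_max; have h := modulus_perturbed_le f y_eta t.
apply/andP; split.
  have : modulus f t - w <= Num.max (modulus f t - w) 0 by rewrite le_max lexx.
  by move=> h'; lra.
by rewrite addr_ge0// le_max lexx orbT.
Qed.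

Lemma excess_perturbed_above w : (forall t, A t -> modulus f t + eta <= w) ->
  (Phi F w <= Phi f w)%E.
Proof.
move=> Aw; rewrite -[leRHS]adde0.
apply: (excess_local mF mf mA AD); first by move=> t; exact: modulus_perturbed_out.
rewrite adde0 integral0_eq; first by apply: integral_ge0 => t _; exact: pospart_ge0.
move=> t At; rewrite max_r// subr_le0.
exact: le_trans (modulus_perturbed_le f y_eta t) (Aw _ At).
Qed.

(** Where [|f|] stays above the level [w], the excess is an integral of [|f| - w],
    to which a perturbation of mean zero contributes nothing. *)
Lemma excess_perturbed_below w : 0 <= w -> (leb A < +oo)%E ->
  (\int[leb]_(t in A) (y t + eta)%:E = eta%:E * leb A)%E ->
  (forall t, A t -> w + eta <= modulus f t) ->
  (Phi F w <= Phi f w)%E.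
Proof.
move=> w0 Afin y_mean Aw; rewrite -[leRHS]adde0.
apply: (excess_local mF mf mA AD); first by move=> t; exact: modulus_perturbed_out.
rewrite adde0 le_eqVlt; apply/orP; left; apply/eqP.
have etaA : (eta%:E * leb A)%E \is a fin_num.
  by rewrite fin_numM// ge0_fin_numE.
have ye t : 0 <= y t + eta.
  by have := y_eta t; rewrite ler_norml => /andP[h _]; lra.
rewrite -[LHS](addeK _ etaA) -[RHS](addeK _ etaA); congr (_ - _)%E.
rewrite -{1}integral_cst; last exact: mA.
rewrite -ge0_integralD; last 5 first.
- exact: mA.
- by move=> t _; exact: pospart_ge0.
- exact: (measurable_pospart_modulus w mF mA AD).
- by move=> t _; rewrite lee_fin.
- exact: measurable_cst.
rewrite -y_mean -ge0_integralD; last 5 first.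
- exact: mA.
- by move=> t _; exact: pospart_ge0.
- exact: (measurable_pospart_modulus w mf mA AD).
- by move=> t _; rewrite lee_fin.
- apply/measurable_EFinP; apply: measurable_funD; last exact: measurable_cst.
  exact: (measurable_funS mD AD my).
apply: eq_integral => t /[!inE] At; have h := Aw _ At.
rewrite -!EFinD; congr EFin.
rewrite (modulus_perturbed_eq y_eta); last by rewrite (le_trans _ h)// lerDr.
have h' := ye t; have h0 := eta0; rewrite !max_l; [ring|lra|lra].
Qed.

End LocalExcess.

Section NecessaryMass.
Context {R : realType}.
Variable alpha : \bar R.
Hypothesis alpha_gt0 : (0 < alpha)%E.
Variable E : banachFunctionSpace alpha.
Hypothesis E_sym : strongly_symmetric E.
Local Notation D := (dom alpha).
Local Notation dist := (Defs.distribution alpha).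
Local Notation mr := (mu_real alpha).
Local Notation K := (partial_mass alpha).
Local Notation Phi := (excess alpha).
Implicit Types (x y : E) (f g : lebR R -> R[i]).

Let mD : measurable D. Proof. exact: measurable_dom. Qed.

(** If [partial_mass (fn x) t < partial_mass (fn h) t], the excesses of [x] and [h]
    differ by a definite amount at the levels near [v], the value at [t] of the
    rearrangement of [x]. Perturbing [|x|] with mean zero at or just below [v] does
    not use up this amount, and increases no excess at the other levels. *)
Lemma k_extreme_partial_mass k x (h : E) : k_extreme k x -> `|h| <= 1 ->
  (forall t, 0 < t -> (K (fn x) t <= K (fn h) t)%E) ->
  forall t, 0 < t -> (t%:E < alpha)%E -> (K (fn h) t <= K (fn x) t)%E.
Proof.
move=> kx h1 Kxh t t0 ta; rewrite leNgt; apply/negP => Klt.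
have [_ x1 _] := kx.
set f := fn x in Kxh Klt *.
have mf : L0 alpha f := fn_L0 x; have ff := finite_rearr_fn E_sym x.
have mh := fn_L0 h; have fh := finite_rearr_fn E_sym h.
set v := mr f t; have v0 : 0 <= v := mu_real_ge0 alpha f t.
have KE := partial_massE mf ff t0; rewrite -/v in KE.
have Kfin (z : E) : K (fn z) t \is a fin_num.
  by rewrite ge0_fin_numE ?partial_mass_ge0// (partial_mass_lty E_sym z t0).
have [kf kfE] : exists r : R, K f t = r%:E.
  by exists (fine (K f t)); rewrite fineK// Kfin.
have [kh khE] : exists r : R, K (fn h) t = r%:E.
  by exists (fine (K (fn h) t)); rewrite fineK// Kfin.
pose gap := kh - kf.
have gap0 : 0 < gap by move: Klt; rewrite kfE khE lte_fin /gap; lra.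
have PhiE : Phi f v = (kf - t * v)%:E.
  by rewrite EFinB -kfE KE addeK.
have Phih e : 0 <= e -> ((kf - t * v + gap - t * e)%:E <= Phi (fn h) (v + e))%E.
  move=> e0; have := partial_mass_le mh fh (addr_ge0 v0 e0) t0.
  rewrite khE -leeBlDr// -EFinB; apply: le_trans.
  by rewrite lee_fin /gap; lra.
have mW u : measurable [set r | D r /\ u < modulus f r <= v].
  have := measurable_modulus mf mD (measurable_itv `]u, v]).
  by congr measurable; apply/seteqP; split => r /=; rewrite in_itv/= => -[].
have dvt : (dist f v <= t%:E)%E by rewrite -mu_real_le.
have t2 : 0 < gap / (2 * t) by rewrite divr_gt0// mulr_gt0.
(* On [W] the values of [|f|] are [v] or just below. Every level [w < v] is near
   [v], or below all values on [W], or of infinite excess; the last case takes the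
   place of a lower bound on [W] when no superlevel set below [v] has finite
   measure. *)
have [e [W [[e0 te] mW' Wv W0 low]]] : exists (e : R) (W : set (lebR R)),
    [/\ 0 < e /\ t * e <= gap / 2, measurable W,
        W `<=` [set r | D r /\ modulus f r <= v], (0 < leb W)%E &
        forall w, 0 <= w -> w < v ->
          [\/ (Phi f w <= Phi f v + (gap / 8)%:E)%E,
              forall r, W r -> w + e / 2 <= modulus f r |
              Phi f w = +oo%E]].
  have te2 : t * (gap / (2 * t)) = gap / 2.
    by rewrite invfM mulrCA [t * _]mulrCA divff ?mulr1// gt_eqF.
  have [[v' [v'0 v'v dv']]|H] :=
      pselect (exists v', [/\ 0 <= v', v' < v & (dist f v' < +oo)%E]).
    have dfin : dist f v' \is a fin_num by rewrite ge0_fin_numE ?dist_ge0.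
    pose M := fine (dist f v'); have M0 : 0 <= M by rewrite fine_ge0 ?dist_ge0.
    pose e := Num.min (v - v') (Num.min (gap / (2 * t)) (gap / (8 * (M + 1)))).
    have M1 : 0 < 8 * (M + 1) by lra.
    have e0 : 0 < e by rewrite !lt_min subr_gt0 v'v t2 divr_gt0.
    have ev' : e <= v - v' by rewrite ge_min lexx.
    have et : e <= gap / (2 * t) by rewrite !ge_min lexx !orbT.
    have eM : e * M <= gap / 8.
      have h8 : e <= gap / (8 * (M + 1)) by rewrite !ge_min lexx !orbT.
      apply: le_trans (ler_wpM2r M0 h8) _.
      have q0 : 0 < gap / (8 * (M + 1)) by rewrite divr_gt0.
      have qE : gap / (8 * (M + 1)) * (8 * (M + 1)) = gap by rewrite divfK// gt_eqF.
      by move: (gap / (8 * (M + 1))) q0 qE => q q0 qE; nra.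
    exists e, [set r | D r /\ v - e / 2 < modulus f r <= v]; split => //.
    - by split => //; rewrite -te2 ler_wpM2l// ltW.
    - by move=> r [Dr /andP[_ rv]].
    - have dlt : (t%:E < dist f (v - e / 2))%E.
        by rewrite -mu_real_gt//; [rewrite -/v; lra|lra].
      have := le_lt_trans dvt dlt; rewrite ltNge => h'; rewrite lt0e measure_ge0 andbT.
      apply: contra h' => /eqP W0.
      apply: ae_le_measure; try exact: measurable_superlevel.
      exists [set r | D r /\ v - e / 2 < modulus f r <= v]; split => //.
      move=> r /= /not_implyP[[Dr er] nr]; split => //; rewrite er/= leNgt.
      by apply/negP => vr; apply: nr.
    - move=> w w0 wv; have [ew|we] := leP (v - e) w; last first.
        by apply: Or32 => r [_ /andP[er _]]; lra.
      apply: Or31.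
      apply: le_trans (excess_step mf (ltW wv)) _; apply: leeD2l.
      apply: (@le_trans _ _ (e%:E * M%:E)%E); last by rewrite -EFinM lee_fin.
      have dw : (dist f w <= M%:E)%E.
        by rewrite /M fineK//; apply: dist_le => //; lra.
      apply: le_trans (lee_wpmul2l _ dw) _; first by rewrite lee_fin; lra.
      by rewrite -!EFinM lee_fin ler_wpM2r//; lra.
  exists (gap / (2 * t)), [set r | D r /\ modulus f r <= v]; split => //.
  - by rewrite te2.
  - have := measurable_modulus mf mD (measurable_itv `]-oo, v]).
    by congr measurable; apply/seteqP; split => r /=; rewrite in_itv/= => -[].
  - have := le_lt_trans dvt ta; rewrite ltNge => h'; rewrite lt0e measure_ge0 andbT.
    apply: contra h' => /eqP W0; rewrite -[leLHS](leb_dom alpha_gt0).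
    apply: ae_le_measure => //; first exact: measurable_superlevel.
    exists [set r | D r /\ modulus f r <= v]; split => //.
      have := measurable_modulus mf mD (measurable_itv `]-oo, v]).
      by congr measurable; apply/seteqP; split => r /=; rewrite in_itv/= => -[].
    move=> r /= /not_implyP[Dr nr]; split => //; rewrite leNgt.
    by apply/negP => vr; apply: nr.
  - move=> w w0 wv; apply: Or33; apply/eqP; rewrite -leye_eq.
    pose w' := (w + v) / 2.
    have dw' : dist f w' = +oo%E.
      apply/eqP; rewrite -leye_eq leNgt; apply/negP => dw'; apply: H.
      by exists w'; split => //; rewrite /w'; lra.
    apply: le_trans (excess_lower mf (_ : w <= w')); last by rewrite /w'; lra.
    by rewrite dw' gt0_muley// lte_fin /w'; lra.
have [d d0 hd] := exists_level E_sym x1.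
have m0 : (0 < Order.min (dist f d) 1%:E)%E by rewrite lt_min hd lte_fin ltr01.
have [|A [mA AW A0 Am]] := small_subset mW' _ W0 m0.
  by move=> r /Wv[[]].
have AD : A `<=` D by move=> r /AW/Wv[].
have [Ad A1] : (leb A < dist f d)%E /\ (leb A < 1%:E)%E.
  by move: Am; rewrite lt_min => /andP[].
pose eta := Num.min d (Num.min (e / 2) (gap / 8)).
have eta0 : 0 < eta by rewrite !lt_min d0 !divr_gt0.
have eta_e : eta <= e / 2 by rewrite !ge_min lexx !orbT.
have eta_gap : eta <= gap / 8 by rewrite !ge_min lexx !orbT.
have etaA : (eta%:E * leb A <= (gap / 8)%:E)%E.
  apply: (@le_trans _ _ (eta%:E * 1%:E)%E); last by rewrite mule1 lee_fin.
  by apply: lee_wpmul2l; [rewrite lee_fin ltW|exact: ltW].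
suff nkx : ~ k_extreme k x by exact: nkx.
apply: (perturbation_not_k_extreme E_sym eta0 _ mA AD A0 Ad).
  by rewrite ge_min lexx.
move=> y x' my y_eta yA y_mean x'E; apply: le_trans h1.
apply: (norm_le_partial_mass E_sym) => s s0.
have mx' := fn_L0 x'; have fx' := finite_rearr_fn E_sym x'.
set w := mr (fn h) s; have w0 : 0 <= w := mu_real_ge0 alpha (fn h) s.
apply: (le_trans (partial_mass_le mx' fx' w0 s0)).
rewrite (partial_massE mh fh s0) -/w leeD2r//.
have mp := L0_perturbed mf my.
rewrite (eqL0_excess w mx' mp x'E).
have fh_w : (Phi f w <= Phi (fn h) w)%E := submajorized_excess mf ff mh fh w0 Kxh.
have pert_le := excess_perturbed_le mf my mA AD yA y_eta w.
have mid : w <= v + e ->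
    (Phi f w <= Phi f v + (gap / 8)%:E)%E -> (Phi (perturbed f y) w <= Phi (fn h) w)%E.
  move=> we le; apply: le_trans (excess_antitone mh we).
  apply: le_trans (Phih e (ltW e0)); apply: (le_trans pert_le).
  apply: (@le_trans _ _ (Phi f v + (gap / 8)%:E + (gap / 8)%:E)%E).
    exact: leeD.
  by rewrite PhiE -!EFinD lee_fin; lra.
have [vw|wv] := leP v w.
  have [we|we] := leP (v + e) w.
    apply: le_trans fh_w.
    apply: (excess_perturbed_above mf my mA AD yA y_eta) => r /AW/Wv[_ rv]; lra.
  apply: mid; first exact: ltW.
  by apply: (le_trans (excess_antitone mf vw)); rewrite leeDl// lee_fin; lra.
case: (low w w0 wv) => [le|We|winf].
- by apply: mid le; apply: ltW; apply: lt_trans wv _; rewrite ltrDl.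
- apply: le_trans fh_w.
  apply: (excess_perturbed_below mf my mA AD yA y_eta w0 _ y_mean).
    by apply: lt_trans A1 _; rewrite ltry.
  by move=> r /AW/We; lra.
- by move: fh_w; rewrite winf leye_eq => /eqP ->; rewrite leey.
Qed.

End NecessaryMass.

(** * Means of functions and means of their rearrangements *)

Section IntegralMean.
Context d (T : measurableType d) {R : realType}.
Variable mu : {measure set T -> \bar R}.

Lemma integral_scaled_sum n (A : set T) (w : R) (phi : 'I_n -> T -> R) :
  measurable A -> 0 <= w -> (forall i, measurable_fun A (phi i)) ->
  (forall i t, A t -> 0 <= phi i t) ->
  (\int[mu]_(t in A) (w * \sum_(i < n) phi i t)%:E =
   w%:E * \sum_(i < n) \int[mu]_(t in A) (phi i t)%:E)%E.
Proof.
move=> mA w0 mphi phi0.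
under eq_integral do rewrite EFinM -sumEFin.
rewrite ge0_integralZl_EFin//; last 2 first.
- by move=> t At; apply: sume_ge0 => i _; rewrite lee_fin phi0.
- by apply: emeasurable_sum => i; exact/measurable_EFinP.
by rewrite ge0_integral_sum// => i; exact/measurable_EFinP.
Qed.

End IntegralMean.

Section ComplexMean.
Context {R : realType}.
Local Notation nc := (@ComplexField.Normc.normc R).

(** Equality in the triangle inequality forces all terms to have the sign of their
    sum. *)
Lemma mean_norm_eq n (w : R) (z : R[i]) (zs : 'I_n -> R[i]) (a : 'I_n -> R) :
  0 < w -> z = w%:C * \sum_(i < n) zs i -> (forall i, nc (zs i) <= a i) ->
  nc z = w * \sum_(i < n) a i -> forall i, zs i = csign z * (a i)%:C.
Proof.
move=> w0 zE za ncz i.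
have s0 : csign z != 0 by rewrite -normr_eq0 norm_csign oner_eq0.
suff H : zs i / csign z = (a i)%:C by rewrite -H mulrC divfK.
have wC0 : w%:C != 0 :> R[i] by rewrite fmorph_eq0 gt_eqF.
apply: (@normC_sum_upper _ _ xpredT (fun i => zs i / csign z) (fun i => (a i)%:C)) => //.
  by move=> j _; rewrite normrM normfV norm_csign invr1 mulr1 norm_normc lecR.
apply: (mulfI wC0); rewrite -mulr_suml mulrA -zE -rmorph_sum/= -rmorphM/= -ncz.
by rewrite {1}(csignE z) mulrC mulKf.
Qed.

End ComplexMean.

Section Characterization.
Context {R : realType}.
Variable alpha : \bar R.
Hypothesis alpha_gt0 : (0 < alpha)%E.
Variable E : banachFunctionSpace alpha.
Hypothesis E_sym : strongly_symmetric E.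
Local Notation D := (dom alpha).
Local Notation rearr := (rearrangement alpha).
Local Notation dist := (Defs.distribution alpha).
Local Notation mr := (mu_real alpha).
Local Notation ml := (mu_left alpha).
Local Notation K := (partial_mass alpha).
Local Notation Phi := (excess alpha).
Local Notation nc := (@ComplexField.Normc.normc R).
Implicit Types (x y h : E).

Let mD : measurable D. Proof. exact: measurable_dom. Qed.

Definition maximal_mass x := forall h, `|h| <= 1 ->
  (forall t, 0 < t -> (K (fn x) t <= K (fn h) t)%E) ->
  forall t, 0 < t -> (t%:E < alpha)%E -> (K (fn h) t <= K (fn x) t)%E.

(** The relation is asked of left limits, which determine the rearrangements up to
    their values at jumps. *)
Definition dependent_means k x := forall u : 'I_k.+1 -> E, (forall i, `|u i| = 1) ->
  (forall X, (0 < X)%E -> (X <= alpha)%E ->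
     ml (fn x) X = k.+1%:R^-1 * \sum_(i < k.+1) ml (fn (u i)) X) ->
  exists2 c : 'I_k.+1 -> R[i], exists i, c i != 0 &
    forall X, (0 < X)%E -> (X <= alpha)%E ->
      \sum_(i < k.+1) c i * (ml (fn (u i)) X)%:C = 0.

Lemma natV_complex (k : nat) : (k.+1%:R^-1 : R)%:C = k.+1%:R^-1 :> R[i].
Proof. by rewrite fmorphV/= rmorph_nat. Qed.

Section Transfer.
Variable x : E.
Hypothesis fa : above_limit alpha (fn x).
Local Notation f := (fn x).
Local Notation rk := (rank alpha f).
Let mf : L0 alpha f := fn_L0 x.
Let ff := finite_rearr_fn E_sym x.

(** The rearrangement of [y], laid out on the domain in the same order as [|f|] and
    with the sign of [f]. *)
Definition carried (y : E) (t : lebR R) : R[i] := csign (f t) * (ml (fn y) (rk t))%:C.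

Lemma represents_carried y : exists2 e : E, represents e (carried y) & `|e| <= `|y|.
Proof.
have my := fn_L0 y; have fy := finite_rearr_fn E_sym y.
have mc : L0 alpha (carried y).
  exact: (L0_mul (L0_csign mf) (L0_real (measurable_mu_left_rank mf ff my fy))).
apply: (E_sym.1 _ _ mc) => t t0.
apply: (rearr_rank_le alpha_gt0 mf ff my fy mc) => s _.
by rewrite /modulus normc_mul normc_csign mul1r normc_real ger0_norm// mu_left_ge0.
Qed.

(** The functions [carried (u i)] have mean [x], so that a relation between them
    exists; divided by the sign of [x], it is one along the rank. *)
Lemma dependent_means_of_k_extreme k : k_extreme k x -> dependent_means k x.
Proof.
move=> kx u u1 uE; have [_ x1 Hx] := kx.
have [e eP] := choice (fun i => (exists2P _ _).1 (represents_carried (u i))).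
have eE i := (eP i).1.
have e1 i : `|e i| <= 1 by rewrite -(u1 i); exact: (eP i).2.
have r0 := rank_gt0_ae mf ff.
have fE := modulus_rank alpha_gt0 mf ff fa.
have xE : x = k.+1%:R^-1 *: \sum_(i < k.+1) e i.
  have h1 := represents_sum (fun=> k.+1%:R^-1 : R[i]) eE.
  rewrite -scaler_sumr in h1; apply: represents_inj h1.
  apply: filterS2 r0 fE => t r0 fE Dt.
  rewrite [LHS]csignE -[nc (f t)]/(modulus f t) fE//.
  rewrite uE; [|exact: r0|exact: rank_le_alpha].
  rewrite rmorphM/= natV_complex rmorph_sum/= mulrCA -mulr_sumr.
  by congr (_ * _); rewrite mulr_sumr.
have [c ci ce] := Hx e (unit_of_mean x1 xE e1) xE.
exists c => //; apply: (linear_relation_of_rank alpha_gt0 mf ff fa).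
have h1 := represents_sum c eE; rewrite ce in h1.
apply: filterS2 h1 (represents0 E) => t h1 h0 Dt.
have : \sum_(i < k.+1) c i * carried (u i) t = 0 by rewrite -h1// h0.
under eq_bigr do rewrite /carried mulrCA.
rewrite -mulr_sumr => /eqP; rewrite mulf_eq0 -normr_eq0 norm_csign oner_eq0/=.
by move/eqP.
Qed.

Section RigidMean.
Variables (k : nat) (u : 'I_k.+1 -> E).
Local Notation w := (k.+1%:R^-1 : R).
Hypothesis uE : x = k.+1%:R^-1 *: \sum_(i < k.+1) u i.
Let mu i : L0 alpha (fn (u i)) := fn_L0 (u i).
Let fu i := finite_rearr_fn E_sym (u i).
Let w0 : 0 <= w. Proof. by rewrite invr_ge0. Qed.

Lemma mean_ae : {ae leb, forall t, D t -> f t = w%:C * \sum_(i < k.+1) fn (u i) t}.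
Proof.
have h1 := represents_sum (fun=> k.+1%:R^-1 : R[i]) (fun i => represents_fn (u i)).
rewrite -scaler_sumr -uE in h1; apply: filterS h1 => t h Dt.
by rewrite h// natV_complex -mulr_sumr.
Qed.

Lemma modulus_mean_le : {ae leb, forall t, D t ->
  modulus f t <= w * \sum_(i < k.+1) modulus (fn (u i)) t}.
Proof.
apply: filterS mean_ae => t h Dt; rewrite -lecR modulusE h//.
rewrite normrM normcR (ger0_norm w0) rmorphM/= rmorph_sum/= ler_wpM2l ?lecR//.
exact: ler_norm_sum.
Qed.

Lemma partial_mass_real y t : 0 < t -> exists r : R, K (fn y) t = r%:E.
Proof.
move=> t0; exists (fine (K (fn y) t)); rewrite fineK//.
by rewrite ge0_fin_numE ?partial_mass_ge0// (partial_mass_lty E_sym y t0).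
Qed.

(** Subadditivity of the K-functional: use the level [w * sum v i] for [f], where
    [v i] is the optimal level for [u i]. *)
Lemma partial_mass_mean_le t : 0 < t ->
  (K f t <= w%:E * \sum_(i < k.+1) K (fn (u i)) t)%E.
Proof.
move=> t0; pose v i := mr (fn (u i)) t; pose V := w * \sum_(i < k.+1) v i.
have v0 i : 0 <= v i := mu_real_ge0 alpha (fn (u i)) t.
have V0 : 0 <= V by rewrite mulr_ge0// sumr_ge0.
apply: (le_trans (partial_mass_le mf ff V0 t0)).
have mex i : measurable_fun D (fun s => Num.max (modulus (fn (u i)) s - v i) 0).
  exact/measurable_EFinP/(measurable_pospart_modulus (v i) (mu i) mD (@subset_refl _ D)).
have le1 : (Phi f V <= w%:E * \sum_(i < k.+1) Phi (fn (u i)) (v i))%E.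
  rewrite -integral_scaled_sum//; last first.
    by move=> i s _; rewrite le_max lexx orbT.
  apply: ae_ge0_le_integral; first exact: mD.
  - by move=> s _; exact: pospart_ge0.
  - exact: (measurable_pospart_modulus V mf mD (@subset_refl _ D)).
  - move=> s _; rewrite lee_fin mulr_ge0// sumr_ge0// => i _.
    by rewrite le_max lexx orbT.
  - apply/measurable_EFinP; apply: measurable_funM; first exact: measurable_cst.
    by apply: measurable_sum => i; exact: mex.
  apply: filterS modulus_mean_le => s h Ds; rewrite lee_fin ge_max.
  apply/andP; split; last first.
    by rewrite mulr_ge0// sumr_ge0// => i _; rewrite le_max lexx orbT.
  rewrite lerBlDr; apply: (le_trans (h Ds)).
  rewrite /V -mulrDr ler_wpM2l// -big_split/=; apply: ler_sum => i _.
  by rewrite -lerBlDr le_max lexx.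
have -> : (w%:E * \sum_(i < k.+1) K (fn (u i)) t =
    w%:E * \sum_(i < k.+1) Phi (fn (u i)) (v i) + (t * V)%:E)%E.
  under eq_bigr => i _ do rewrite (partial_massE (mu i) (fu i) t0) -/(v i).
  rewrite big_split/= ge0_muleDr; last 2 first.
  - by apply: sume_ge0 => i _; exact: excess_ge0.
  - by apply: sume_ge0 => i _; rewrite lee_fin mulr_ge0// ltW.
  congr (_ + _)%E; rewrite sumEFin -EFinM /V; congr EFin.
  by rewrite -mulr_sumr mulrCA.
exact: leeD2r.
Qed.

(** Take for [h] the mean of the rearrangements. Being a mean of decreasing
    functions, it has its largest values on [[0, t)]. *)
Lemma mean_rearrangement : (forall i, `|u i| <= 1) ->
  exists2 h : E, `|h| <= 1 &
    forall t, 0 < t -> (w%:E * \sum_(i < k.+1) K (fn (u i)) t <= K (fn h) t)%E.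
Proof.
move=> u1.
have rep i : exists2 e : E, represents e (rearrangement_fun alpha (fn (u i))) & `|e| <= `|u i|.
  apply: (E_sym.1 _ _ (L0_rearrangement_fun (mu i))) => t t0.
  by rewrite (rearr_rearrangement_fun t (mu i) (fu i) alpha_gt0).
have [e eP] := choice (fun i => (exists2P _ _).1 (rep i)).
have eE i := (eP i).1.
exists (k.+1%:R^-1 *: \sum_(i < k.+1) e i).
  rewrite normrZ normfV normr_nat mulrC ler_pdivrMr ?ltr0n// mul1r.
  apply: le_trans (ler_norm_sum _ _ _) _.
  rewrite -[leRHS]mulr_natl mulr1 -[X in _ <= X%:R](card_ord k.+1) -sumr_const.
  by apply: ler_sum => i _; apply: le_trans (u1 i); exact: (eP i).2.
set h := _ *: _ => t t0.
pose B : set (lebR R) := [set` `]0, t[] `&` D.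
have mB : measurable B by apply: measurableI => //; exact: measurable_lebR_itv.
have BD : B `<=` D by exact: subIsetr.
have Bt : (leb B <= t%:E)%E.
  rewrite -(leb_itv0 t0); apply: le_measure; last exact: subIsetl.
    by rewrite inE.
  by rewrite inE; exact: measurable_lebR_itv.
apply: le_trans (integral_le_partial_mass (fn_L0 h) (finite_rearr_fn E_sym h) t0 mB BD Bt).
have mmr i : measurable_fun B (mr (fn (u i)) : lebR R -> R).
  apply: (measurable_funS (measurable_lebR_itv `]0, +oo[) _ (measurable_mu_real (mu i) (fu i))).
  by move=> s [/=]; rewrite !in_itv/= andbT => /andP[].
have hE : {ae leb, forall s, D s -> modulus (fn h) s = w * \sum_(i < k.+1) mr (fn (u i)) s}.
  have h1 := represents_sum (fun=> k.+1%:R^-1 : R[i]) eE.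
  rewrite -scaler_sumr in h1; apply: filterS h1 => s h1 Ds.
  rewrite /modulus h1// -mulr_sumr.
  rewrite (_ : _ * _ = (w * \sum_(i < k.+1) mr (fn (u i)) s)%:C); last first.
    by rewrite rmorphM/= rmorph_sum/= natV_complex.
  rewrite normc_real ger0_norm//.
  by rewrite mulr_ge0// sumr_ge0// => i _; exact: mu_real_ge0.
have -> : (\int[leb]_(s in B) (modulus (fn h) s)%:E =
    \int[leb]_(s in B) (w * \sum_(i < k.+1) mr (fn (u i)) s)%:E)%E.
  apply: ge0_ae_eq_integral; first exact: mB.
  - apply/measurable_EFinP.
    exact: (measurable_funS mD BD (measurable_modulus (fn_L0 h))).
  - apply/measurable_EFinP; apply: measurable_funM; first exact: measurable_cst.
    by apply: measurable_sum => i; exact: mmr.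
  - by move=> s _; rewrite lee_fin modulus_ge0.
  - move=> s _; rewrite lee_fin mulr_ge0// sumr_ge0// => i _.
    exact: mu_real_ge0.
  - by apply: filterS hE => s hs Bs; rewrite hs//; exact: BD.
rewrite (integral_scaled_sum leb mB w0 mmr); last by move=> i s _; exact: mu_real_ge0.
rewrite le_eqVlt; apply/orP; left; apply/eqP; congr (_ * _)%E.
apply: eq_bigr => i _; rewrite /partial_mass [LHS]integral_mkcond [RHS]integral_mkcond.
apply: eq_integral => s _; rewrite !patchE.
case: ifPn => [/set_mem st|st].
  case: ifPn => // /negP sB.
  have nD : ~ D s by move=> Ds; apply: sB; rewrite inE.
  rewrite /mu_real rearr_ge_alpha//.
  rewrite leNgt; apply/negP => sa; apply: nD; split => //.
  by move: st; rewrite /= in_itv/= => /andP[/ltW].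
by case: ifPn => // /set_mem[/mem_set]; rewrite (negPf st).
Qed.

End RigidMean.
End Transfer.

(** In the proof of the inequality of Hardy and Littlewood, equality leaves no room
    outside of [B] for an excess over the optimal level. *)
Lemma extremal_set y (B : set (lebR R)) r : 0 < r -> measurable B -> B `<=` D ->
  leb B = r%:E -> (\int[leb]_(t in B) (modulus (fn y) t)%:E = K (fn y) r)%E ->
  {ae leb, forall t, D t -> ~ B t -> modulus (fn y) t <= mr (fn y) r}.
Proof.
move=> r0 mB BD lB IB; have my := fn_L0 y; have fy := finite_rearr_fn E_sym y.
pose v := mr (fn y) r; have v0 : 0 <= v := mu_real_ge0 alpha (fn y) r.
pose ex t := (Num.max (modulus (fn y) t - v) 0)%:E.
have mexD : measurable_fun D ex := measurable_pospart_modulus v my mD (@subset_refl _ D).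
have mDB : measurable (D `\` B) by exact: measurableD.
have mexB : measurable_fun (D `\` B) ex := measurable_funS mD (@subDsetl _ D B) mexD.
have PhiE : Phi (fn y) v = (\int[leb]_(t in B) ex t + \int[leb]_(t in D `\` B) ex t)%E.
  have DE : D = B `|` (D `\` B) by rewrite (setDUK BD).
  rewrite /excess {1}DE ge0_integral_setU; first by [].
  - exact: mB.
  - exact: mDB.
  - by rewrite -DE; exact: mexD.
  - by move=> t _; exact: pospart_ge0.
  - by apply/disj_set2P/seteqP; split => t //= -[Bt []].
have KE := partial_massE my fy r0; rewrite -/v in KE.
have [a aE] := partial_mass_real y r0.
have PhiR : Phi (fn y) v = (a - r * v)%:E by rewrite EFinB -aE KE addeK.
have IB0 : (0 <= \int[leb]_(t in B) ex t)%E by apply: integral_ge0 => t _; exact: pospart_ge0.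
have ID0 : (0 <= \int[leb]_(t in D `\` B) ex t)%E by apply: integral_ge0 => t _; exact: pospart_ge0.
have IBfin : (\int[leb]_(t in B) ex t)%E \is a fin_num.
  rewrite ge0_fin_numE//; apply: (@le_lt_trans _ _ (Phi (fn y) v)).
    by rewrite PhiE leeDl.
  by rewrite PhiR ltry.
have I0 : (\int[leb]_(t in D `\` B) ex t = 0)%E.
  apply/eqP; rewrite eq_le ID0 andbT.
  have mgB : measurable_fun B (modulus (fn y)) := measurable_funS mD BD (measurable_modulus my).
  have := integral_le_level leb mB mgB v0 (fun t _ => modulus_ge0 (fn y) t).
  rewrite IB KE PhiE /= lB -EFinM [(v * r)%R]mulrC addeC leeD2lE// -/ex.
  by rewrite -[leRHS]adde0 leeD2lE.
have : ae_eq leb (D `\` B) ex (cst 0%E).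
  apply/(ae_eq_integral_abs leb mDB mexB).
  rewrite -[RHS]I0; apply: eq_integral => t _.
  by rewrite gee0_abs// pospart_ge0.
apply: filterS => t h Dt nBt; have := h (conj Dt nBt) => -[] /eqP.
by move=> /eqP/max_idPr; rewrite subr_le0.
Qed.

Section Sufficient.
Variable x : E.
Hypothesis fa : above_limit alpha (fn x).
Local Notation f := (fn x).
Local Notation rk := (rank alpha f).
Let mf : L0 alpha f := fn_L0 x.
Let ff := finite_rearr_fn E_sym x.

Lemma integral_rank_set r : 0 < r -> (r%:E < alpha)%E ->
  (\int[leb]_(t in [set t | D t /\ (rk t <= r%:E)%E]) (modulus f t)%:E = K f r)%E.
Proof.
move=> r0 ra; pose B := [set t | D t /\ (rk t <= r%:E)%E].
have mB : measurable B by exact: measurable_rank_le.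
have lB : leb B = r%:E by exact: leb_rank.
have BD : B `<=` D by move=> t [].
have v0 : 0 <= mr f r := mu_real_ge0 alpha f r.
have mgB : measurable_fun B (modulus f) := measurable_funS mD BD (measurable_modulus mf).
have vB t : B t -> mr f r <= modulus f t.
  move=> [Dt rt]; rewrite leNgt; apply/negP => lt.
  by have := lt_le_trans (rank_lt_level mf ff r0 lt) rt; rewrite ltxx.
rewrite -/B (integral_eq_level leb mB mgB v0 vB) /= lB -EFinM.
rewrite (partial_massE mf ff r0) addeC mulrC; congr (_ + _)%E.
rewrite /excess [LHS]integral_mkcond [RHS]integral_mkcond; apply: eq_integral => t _.
rewrite !patchE; case: ifPn => [/set_mem[Dt _]|tB]; first by rewrite mem_set.
case: ifPn => // /set_mem Dt; rewrite max_r// subr_le0 leNgt; apply/negP => lt.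
by move/negP: tB; apply; rewrite inE; split => //; exact: rank_gt_level.
Qed.

(** On the set of points of rank at most [r], the integral of [|f|] is the primitive
    at [r], and the hypothesis forces equality in the inequality of Hardy and
    Littlewood for every [u i]. By [extremal_set], [|u i|] is then at most the left
    limit of its rearrangement at the rank. The means of both sides of this bound
    agree, so [mean_norm_eq] applies. *)
Lemma rigid_mean k (u : 'I_k.+1 -> E) :
  x = k.+1%:R^-1 *: \sum_(i < k.+1) u i ->
  (forall t, 0 < t -> (t%:E < alpha)%E ->
     K f t = ((k.+1%:R^-1)%:E * \sum_(i < k.+1) K (fn (u i)) t)%E) ->
  {ae leb, forall t, D t -> forall i, fn (u i) t = carried x (u i) t}.
Proof.
move=> uE KE; pose w : R := k.+1%:R^-1.
have w0 : 0 < w by rewrite invr_gt0.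
have mu i : L0 alpha (fn (u i)) := fn_L0 (u i).
have fu i := finite_rearr_fn E_sym (u i).
pose B r := [set t | D t /\ (rk t <= r%:E)%E].
have bound r i : 0 < r -> (r%:E < alpha)%E ->
    {ae leb, forall t, D t -> ~ B r t -> modulus (fn (u i)) t <= mr (fn (u i)) r}.
  move=> r0 ra.
  have mB : measurable (B r) by exact: measurable_rank_le.
  have lB : leb (B r) = r%:E by exact: leb_rank.
  have BD : B r `<=` D by move=> t [].
  apply: (extremal_set r0 mB BD lB).
  have [kap kapE] := choice (fun j => partial_mass_real (u j) r0).
  have mgB j : measurable_fun (B r) (modulus (fn (u j))).
    exact: (measurable_funS mD BD (measurable_modulus (mu j))).
  have HL j : (\int[leb]_(t in B r) (modulus (fn (u j)) t)%:E <= (kap j)%:E)%E.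
    by rewrite -kapE; apply: integral_le_partial_mass => //; rewrite lB.
  have exI j : exists c : R,
      (\int[leb]_(t in B r) (modulus (fn (u j)) t)%:E)%E = c%:E.
    exists (fine (\int[leb]_(t in B r) (modulus (fn (u j)) t)%:E)%E).
    rewrite fineK// ge0_fin_numE; first by apply: le_lt_trans (HL j) _; rewrite ltry.
    by apply: integral_ge0 => t _; rewrite lee_fin modulus_ge0.
  have [I IE] := choice exI.
  have Ikap j : I j <= kap j by rewrite -lee_fin -IE.
  have sumle : \sum_(j < k.+1) kap j <= \sum_(j < k.+1) I j.
    rewrite -(ler_pM2l w0) -lee_fin.
    have -> : (w * \sum_(j < k.+1) kap j)%:E = K f r.
      rewrite (KE r r0 ra) EFinM -sumEFin; congr (_ * _)%E.
      by apply: eq_bigr => j _.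
    rewrite -(integral_rank_set r0 ra) EFinM -sumEFin.
    under eq_bigr => j _ do rewrite -IE.
    rewrite -(integral_scaled_sum leb mB (ltW w0) mgB); last first.
      by move=> j t _; exact: modulus_ge0.
    apply: ae_ge0_le_integral; first exact: mB.
    - by move=> t _; rewrite lee_fin modulus_ge0.
    - apply/measurable_EFinP.
      exact: (measurable_funS mD BD (measurable_modulus mf)).
    - move=> t _; rewrite lee_fin (mulr_ge0 (ltW w0))// sumr_ge0// => j _.
      exact: modulus_ge0.
    - apply/measurable_EFinP; apply: measurable_funM; first exact: measurable_cst.
      by apply: measurable_sum => j; exact: mgB.
    by apply: filterS (modulus_mean_le uE) => t h Bt; rewrite lee_fin h//; exact: BD.
  rewrite IE kapE; congr EFin; apply/eqP; rewrite eq_le Ikap/=.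
  rewrite -subr_le0; apply: (@le_trans _ _ (\sum_(j < k.+1) (kap j - I j))).
    rewrite (bigD1 i)//= lerDl sumr_ge0// => j _.
    by rewrite subr_ge0.
  by rewrite sumrB subr_le0.
have mlE : forall X, (0 < X)%E -> (X <= alpha)%E ->
    ml f X = w * \sum_(i < k.+1) ml (fn (u i)) X.
  apply: (mu_left_mean (ltW w0) mf ff mu fu _ KE) => i t t0.
  exact: (partial_mass_lty E_sym).
have r0 := rank_gt0_ae mf ff.
have fE := modulus_rank alpha_gt0 mf ff fa.
have bq : {ae leb, forall t (q : rat), 0 < (ratr q : R) -> ((ratr q)%:E < alpha)%E ->
    forall i, D t -> ~ B (ratr q) t -> modulus (fn (u i)) t <= mr (fn (u i)) (ratr q)}.
  apply: ae_forall_rat => q.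
  have [q0|q0] := ltP 0 (ratr q : R); last by apply: aeW.
  have [qa|qa] := ltP (ratr q : R)%:E alpha; last by apply: aeW.
  suff : {ae leb, forall t (i : 'I_k.+1), D t -> ~ B (ratr q) t ->
      modulus (fn (u i)) t <= mr (fn (u i)) (ratr q)}.
    by apply: filterS => t h _ _.
  have : {ae leb, forall t (n : nat), D t -> ~ B (ratr q) t ->
      modulus (fn (u (inord n))) t <= mr (fn (u (inord n))) (ratr q)}.
    by apply: ae_foralln => n; exact: bound.
  by apply: filterS => t h i; have := h i; rewrite inord_val.
apply: filterS2 (filterI r0 fE) (filterI bq (mean_ae uE)) => t [{}r0 {}fE] [{}bq fm] Dt i.
have {}r0 := r0 Dt; have ra : (rk t <= alpha)%E by exact: rank_le_alpha.
rewrite /carried; apply: (@mean_norm_eq _ _ w (f t) (fun j => fn (u j) t)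
  (fun j => ml (fn (u j)) (rk t)) w0 (fm Dt)) => [j|].
  apply: le_mu_left => // r r1 rt.
  have [r' [rr' r't]] : exists r', r < r' /\ (r'%:E < rk t)%E.
    case: (rk t) rt => [x'| |] //.
      by rewrite lte_fin => rx; exists ((r + x') / 2); rewrite lte_fin; split; lra.
    by move=> _; exists (r + 1); rewrite ltry; split => //; lra.
  have [q] := rat_in_itvoo rr'; rewrite in_itv/= => /andP[rq qr'].
  have q0 := lt_trans r1 rq.
  have qt : ((ratr q : R)%:E < rk t)%E by apply: lt_trans r't; rewrite lte_fin.
  apply: (@le_trans _ _ (mr (fn (u j)) (ratr q))).
    apply: bq => //; first exact: lt_le_trans ra.
    by move=> [_]; rewrite leNgt qt.
  by apply: mu_real_noninc => //; exact: ltW.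
by rewrite -mlE// -fE.
Qed.

Lemma k_extreme_of_dependent_means k : `|x| = 1 ->
  (exists v : 'I_k.+1 -> E, ~ linearly_dependent v) ->
  maximal_mass x -> dependent_means k x -> k_extreme k x.
Proof.
move=> x1 dimE maxx depx; split => // u u1 uE.
have u_le i : `|u i| <= 1 by rewrite u1.
have [h h1 hK] := mean_rearrangement u_le.
have KE t : 0 < t -> (t%:E < alpha)%E ->
    K f t = ((k.+1%:R^-1)%:E * \sum_(i < k.+1) K (fn (u i)) t)%E.
  move=> t0 ta; apply/eqP; rewrite eq_le partial_mass_mean_le//=.
  apply: (le_trans (hK t t0)); apply: (maxx h h1 _ t t0 ta) => s s0.
  exact: le_trans (partial_mass_mean_le uE s0) (hK s s0).
have ae_u := rigid_mean uE KE.
have mu i : L0 alpha (fn (u i)) := fn_L0 (u i).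
have fu i := finite_rearr_fn E_sym (u i).
have [|c ci cE] := depx u u1.
  apply: (mu_left_mean _ mf ff mu fu _ KE); first by rewrite invr_ge0.
  by move=> i t t0; exact: (partial_mass_lty E_sym).
exists c => //; apply: represents_inj (represents0 E).
have h2 := represents_sum c (fun i => represents_fn (u i)).
apply: represents_eq h2 _.
apply: filterS2 (rank_gt0_ae mf ff) ae_u => t r0 ut Dt.
under eq_bigr => i _ do rewrite ut// /carried mulrCA.
rewrite -mulr_sumr cE ?mulr0//; first exact: r0.
exact: rank_le_alpha.
Qed.

End Sufficient.
End Characterization.

(** * Bounding the modulus below by the limit of the rearrangement *)

Section LimitAtInfinity.
Context {R : realType}.
Variable alpha : \bar R.
Hypothesis alpha_gt0 : (0 < alpha)%E.
Implicit Types f : lebR R -> R[i].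
Local Notation D := (dom alpha).
Local Notation rearr := (rearrangement alpha).
Local Notation dist := (Defs.distribution alpha).

Lemma rearrangement_inftyE f : L0 alpha f ->
  rearrangement_infty alpha f = ereal_inf (range (rearr f)).
Proof.
move=> mf; apply: cvg_lim => //.
by apply: nonincreasing_cvge => s t st; exact: rearr_noninc.
Qed.

Lemma above_limitP f : L0 alpha f ->
  above_limit alpha f <-> {ae leb, forall t : lebR R, D t ->
    (rearrangement_infty alpha f <= (modulus f t)%:E)%E}.
Proof.
move=> mf; rewrite rearrangement_inftyE//; split=> [fa|fc s s0 ds].
  have : {ae leb, forall t (q : rat), 0 <= (ratr q : R) ->
      ((ratr q : R)%:E < ereal_inf (range (rearr f)))%E -> D t -> ratr q <= modulus f t}.
    apply: ae_forall_rat => q.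
    have [[q0 qc]|H] := pselect (0 <= (ratr q : R) /\
        ((ratr q : R)%:E < ereal_inf (range (rearr f)))%E); last first.
      by apply: aeW => t q0 qc; exfalso; apply: H.
    have dq : dist f (ratr q) = +oo%E.
      apply/eqP; rewrite eq_le leey/= leNgt; apply/negP => dq.
      have dfin : dist f (ratr q) \is a fin_num by rewrite ge0_fin_numE ?dist_ge0.
      have : (rearr f (fine (dist f (ratr q))) <= (ratr q : R)%:E)%E.
        by rewrite rearr_le// fineK.
      apply/negP; rewrite -ltNge; apply: (lt_le_trans qc).
      by apply: ereal_inf_lbound; eexists.
    by apply: filterS (fa _ q0 dq) => t h _ _.
  apply: filterS => t h Dt; rewrite leNgt; apply/negP => lt.
  have [r [gr rc]] : exists r : R, modulus f t < r /\ (r%:E < ereal_inf (range (rearr f)))%E.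
    case: (ereal_inf _) lt => [c| |] //.
      by rewrite lte_fin => gc; exists ((modulus f t + c) / 2); rewrite lte_fin; split; lra.
    by move=> _; exists (modulus f t + 1); rewrite ltry; split => //; lra.
  have [q] := rat_in_itvoo gr; rewrite in_itv/= => /andP[gq qr].
  suff : ratr q <= modulus f t by rewrite leNgt gq.
  apply: h => //; first by rewrite (le_trans (modulus_ge0 f t))// ltW.
  by apply: lt_trans rc; rewrite lte_fin.
apply: filterS fc => t h Dt; rewrite -lee_fin; apply: le_trans (h Dt).
apply: le_ereal_inf_tmp => _ [r _ <-].
by rewrite ltW// rearr_gt// ds ltry.
Qed.

(** If some superlevel set has finite measure, the measures tend to zero as the
    level grows. *)
Lemma finite_or_infinite_rearr f : L0 alpha f -> finite_rearrangement alpha f \/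
  forall t, rearr f t = +oo%E.
Proof.
move=> mf; have [[s s0 ds]|H] := pselect (exists2 s, 0 <= s & (dist f s < +oo)%E).
  left => t t0; rewrite ltey; apply/eqP => rt.
  pose G (n : nat) := [set u | D u /\ s + n%:R < modulus f u].
  have mG n : measurable (G n) by exact: measurable_superlevel.
  have G0 : (leb (G 0%N) < +oo)%E by rewrite /G addr0.
  have niG : {homo G : n m / (n <= m)%N >-> (m <= n)%O}.
    move=> n m nm; apply/subsetPset => u [Du mu]; split => //.
    by apply: le_lt_trans mu; rewrite lerD2l ler_nat.
  have C := nonincreasing_cvg_mu (mu := leb) G0 mG (bigcapT_measurable mG) niG.
  have GE : \bigcap_n G n = set0.
    apply/seteqP; split => // u /(_ (Num.truncn (modulus f u)).+1 I)[_].
    have := truncnS_gt (modulus f u) => h; rewrite ltNge => /negP; apply.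
    by rewrite (le_trans (ltW h))// lerDr.
  rewrite GE measure0 in C.
  suff : (t%:E <= 0)%E by rewrite lee_fin leNgt t0.
  rewrite -(cvg_lim _ C)//; apply: lime_ge; first by apply/cvg_ex; eexists; exact: C.
  apply: nearW => n; rewrite ltW// -/(dist f (s + n%:R)) -rearr_gt//; last exact: addr_ge0.
  by rewrite rt ltry.
right => t; apply/eqP; rewrite -leye_eq; apply: le_ereal_inf_tmp => _ [s [s0 st] <-].
exfalso; apply: H; exists s; first exact: ltW.
by apply: le_lt_trans st _; rewrite ltry.
Qed.

Lemma above_limit_rearrangement_fun f : L0 alpha f -> finite_rearrangement alpha f ->
  above_limit alpha (rearrangement_fun alpha f).
Proof.
move=> mf ff s s0; rewrite dist_rearrangement_fun// => ds.
exists [set 0]; split; first by apply: measurable_lebR; exact: measurable_set1.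
  exact: leb_set1.
move=> t /= /not_implyP[[t0 _] /negP]; rewrite -ltNge /modulus normc_real => lt.
apply: contrapT => tn0; have {}t0 : 0 < t by rewrite lt_neqAle t0 andbT eq_sym; apply/eqP.
move: lt; rewrite ger0_norm ?mu_real_ge0// ltNge => /negP; apply.
by rewrite ltW// mu_real_gt// ds ltry.
Qed.

Lemma above_limit_eqL0 f g : L0 alpha f -> L0 alpha g -> eqL0 alpha f g ->
  above_limit alpha f -> above_limit alpha g.
Proof.
move=> mf mg fg fa s s0 ds.
have H := fa s s0; rewrite (eqL0_dist s mf mg fg) in H.
by apply: filterS2 fg (H ds) => t h h' Dt; rewrite /modulus -h//; exact: h'.
Qed.

End LimitAtInfinity.

(** * The characterization *)

Section Transport.
Context {R : realType}.
Variable alpha : \bar R.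
Hypothesis alpha_gt0 : (0 < alpha)%E.
Variable E : banachFunctionSpace alpha.
Hypothesis E_sym : strongly_symmetric E.
Local Notation rearr := (rearrangement alpha).

(** The conditions [maximal_mass] and [dependent_means] involve rearrangements
    only. *)
Lemma k_extreme_equimeasurable k (x y : E) :
  (forall t, rearr (fn x) t = rearr (fn y) t) -> above_limit alpha (fn y) ->
  k_extreme k x -> k_extreme k y.
Proof.
move=> xy ya kx; have xa := k_extreme_above_limit E_sym kx; have [dimE x1 _] := kx.
have Kxy t : partial_mass alpha (fn x) t = partial_mass alpha (fn y) t.
  by apply: eq_integral => s _; rewrite /mu_real xy.
have mlxy X : mu_left alpha (fn x) X = mu_left alpha (fn y) X.
  by rewrite /mu_left /mu_real; congr inf; apply: eq_imagel => r _; rewrite xy.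
have y1 : `|y| = 1.
  rewrite -x1; apply/eqP; rewrite eq_le.
  by rewrite !(norm_le_rearr E_sym)// => t _; rewrite xy.
apply: (k_extreme_of_dependent_means alpha_gt0 E_sym ya y1 dimE).
- move=> h h1 Kyh t t0 ta; rewrite -Kxy.
  apply: (k_extreme_partial_mass alpha_gt0 E_sym kx h1 _ t0 ta) => s s0.
  by rewrite Kxy; exact: Kyh.
- move=> u u1 uE; apply: (dependent_means_of_k_extreme alpha_gt0 E_sym xa kx u1).
  by move=> X X0 Xa; rewrite mlxy uE.
Qed.

End Transport.

Theorem corollary3p15 (R : realType) (alpha : \bar R) (alpha_gt0 : (0 < alpha)%E)
    (E : banachFunctionSpace alpha) (E_sym : strongly_symmetric E)
    (k : nat) (f : lebR R -> R[i]) (f_L0 : L0 alpha f) :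
  k_extreme_fun E k f <->
  (k_extreme_fun E k (rearrangement_fun alpha f) /\
   {ae leb, forall t : lebR R, dom alpha t ->
      (rearrangement_infty alpha f <= (modulus f t)%:E)%E}).
Proof.
rewrite -above_limitP//; split.
  move=> [x xf kx].
  have rxf t : rearrangement alpha (fn x) t = rearrangement alpha f t.
    exact: represents_rearr.
  have ff : finite_rearrangement alpha f.
    by move=> t t0; rewrite -rxf; exact: (finite_rearr_fn E_sym).
  have mmu := L0_rearrangement_fun f_L0.
  have rmu t : rearrangement alpha (rearrangement_fun alpha f) t = rearrangement alpha f t.
    exact: rearr_rearrangement_fun.
  have fa : above_limit alpha f.
    apply: (above_limit_eqL0 (fn_L0 x) f_L0 xf).
    exact: (k_extreme_above_limit E_sym kx).
  split => //.
  have [m mE _] : exists2 m : E, represents m (rearrangement_fun alpha f) & `|m| <= `|x|.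
    by apply: (E_sym.1 _ _ mmu) => t _; rewrite rmu rxf.
  exists m => //; apply: k_extreme_equimeasurable kx => // [t|].
    by rewrite rxf (represents_rearr t mmu mE) rmu.
  apply: (above_limit_eqL0 mmu (fn_L0 m)) (above_limit_rearrangement_fun alpha_gt0 f_L0 ff).
  by apply: filterS mE => t h Dt; rewrite h.
move=> [[m mE km] fa]; have [_ m1 _] := km.
have mmu := L0_rearrangement_fun f_L0.
have ff : finite_rearrangement alpha f.
  have [//|rinf] := finite_or_infinite_rearr f_L0.
  have m0 : m = 0.
    apply: represents_inj mE _; apply: represents_eq (represents0 E) _.
    by apply: aeW => t _; rewrite /rearrangement_fun rinf.
  by move: m1; rewrite m0 normr0 => /eqP; rewrite eq_sym oner_eq0.
have rmu t : rearrangement alpha (fn m) t = rearrangement alpha f t.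
  by rewrite (represents_rearr t mmu mE) rearr_rearrangement_fun.
have [x xf _] : exists2 x : E, represents x f & `|x| <= `|m|.
  by apply: (E_sym.1 _ _ f_L0) => t _; rewrite rmu.
exists x => //; apply: k_extreme_equimeasurable km => // [t|].
  by rewrite rmu (represents_rearr t f_L0 xf).
apply: (above_limit_eqL0 f_L0 (fn_L0 x)) fa.
by apply: filterS xf => t h Dt; rewrite h.
Qed.
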